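(* Let $M$ be a PL (piecewise linear) manifold. Then $\mathrm{PL}(M)$ does not admit a Polish group topology.
   Context: Let $I$ be the unit interval and $I^n$ the $n$-cube. An orientation preserving homeomorphism $f$ of $I^n$ is piecewise linear if there exists a subdivision of $I^n$ into finitely many linear simplices so that the restriction of $f$ to each simplex is an affine linear homeomorphism onto its image; $\mathrm{PL}(I^n)$ denotes the group of piecewise linear homeomorphisms of $I^n$. A manifold $M$ has a PL structure (is a PL manifold) if it is locally modeled on $(I^n, \mathrm{PL}(I^n))$, in which case $\mathrm{PL}(M)$, the group of piecewise linear homeomorphisms of $M$, is the automorphism group of this structure. A Polish group topology on a group is a separable and completely metrizable topology for which the group is a topological group (multiplication and inversion are continuous). *)

(* Defs.v *)
From HB Require Import structures.
From mathcomp Require Import all_boot all_order all_algebra.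
From mathcomp Require Import all_classical all_reals.
From mathcomp Require Import topology normedtype.

Set Implicit Arguments.
Unset Strict Implicit.
Unset Printing Implicit Defensive.

Import Order.TTheory GRing.Theory Num.Theory.
Import numFieldNormedType.Exports.

Local Open Scope classical_set_scope.
Local Open Scope ring_scope.

(* Partial maps are total functions of which only the restriction to the
   relevant domain is meaningful. *)
Definition homeo_between (X Y : topologicalType) (A : set X) (B : set Y)
    (f : X -> Y) : Prop :=
  exists g : Y -> X,
    [/\ set_fun A B f, set_fun B A g,
        {in A, cancel f g} /\ {in B, cancel g f},
        {within A, continuous f} & {within B, continuous g}].

Definition homeomorphism (X Y : topologicalType) (f : X -> Y) : Prop :=
  exists g : Y -> X,
    [/\ cancel f g, cancel g f, continuous f & continuous g].

Section Cube.
Variables (R : realType) (n : nat).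

Definition cube : set 'rV[R]_n := [set x | forall i, 0 <= x 0 i <= 1].

(* The rows of [v] are the vertices; [a] selects the vertices of the face, and
   [face v finset.set0] is empty. *)
Definition face (v : 'M[R]_(n.+1, n)) (a : {set 'I_n.+1}) : set 'rV[R]_n :=
  [set w *m v | w in
    [set w : 'rV[R]_n.+1 | [/\ forall i, 0 <= w 0 i, \sum_i w 0 i = 1 &
                               forall i, i \notin a -> w 0 i = 0]]].

Definition simplex (v : 'M[R]_(n.+1, n)) : set 'rV[R]_n :=
  face v [set: 'I_n.+1]%SET.

Definition affinely_independent (v : 'M[R]_(n.+1, n)) : bool :=
  row_free (row_mx v (const_mx 1 : 'cV[R]_n.+1)).

(* A subdivision is given by its simplices of maximal dimension. *)
Definition subdivision (K : seq 'M[R]_(n.+1, n)) : Prop :=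
  [/\ all affinely_independent K,
      \bigcup_(v in [set` K]) simplex v = cube &
      forall u v, u \in K -> v \in K -> exists a b : {set 'I_n.+1},
        simplex u `&` simplex v = face u a /\ face u a = face v b].

(* [oriented = true] requires the homeomorphism to be orientation preserving,
   i.e. each of its affine pieces to be so; [oriented = false] drops that
   requirement. *)
Definition pl_homeo_cube (oriented : bool) : set ('rV[R]_n -> 'rV[R]_n) :=
  [set f | homeo_between cube cube f /\
    exists2 K, subdivision K & forall v, v \in K ->
      exists (A : 'M[R]_n) (b : 'rV[R]_n),
        (if oriented then 0 < \det A else \det A != 0) /\
        forall x, simplex v x -> f x = x *m A + b].

(* The group generated by the PL homeomorphisms of the cube.  It consists of
   these homeomorphisms only, as they are closed under composition and
   inversion (by taking common subdivisions). *)
Inductive PL_cube (oriented : bool) : ('rV[R]_n -> 'rV[R]_n) -> Prop :=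
| PL_cube_gen f : pl_homeo_cube oriented f -> PL_cube oriented f
| PL_cube_id : PL_cube oriented id
| PL_cube_comp f g :
    PL_cube oriented f -> PL_cube oriented g -> PL_cube oriented (f \o g)
| PL_cube_inv f g :
    PL_cube oriented f -> set_fun cube cube g -> {in cube, cancel g f} ->
    PL_cube oriented g.

End Cube.

Section PLManifold.
Variables (R : realType) (oriented : bool) (n : nat) (M : topologicalType).

Record chart := Chart { chart_dom : set M ; chart_map :> M -> 'rV[R]_n }.

Definition is_chart (c : chart) : Prop :=
  open (chart_dom c) /\
  exists2 O : set 'rV[R]_n, open O &
    homeo_between (chart_dom c) (@cube R n `&` O) c.

(* [f] read in the charts [c] and [d] agrees, near every point where this makes
   sense, with an element of PL(I^n).  As [c] is a homeomorphism onto a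
   relatively open subset of the cube, nearness can be expressed in M. *)
Definition locally_PL (c d : chart) (f : M -> M) : Prop :=
  forall x, chart_dom c x -> chart_dom d (f x) ->
    exists2 g, @PL_cube R n oriented g & \forall y \near x, d (f y) = g (c y).

Record PL_structure := PLStructure {
  atlas : set chart ;
  atlas_chart : forall c, atlas c -> is_chart c ;
  atlas_cover : forall x, exists2 c, atlas c & chart_dom c x ;
  atlas_compat : forall c d, atlas c -> atlas d -> locally_PL c d id }.

Definition PL_automorphism (S : PL_structure) (f : M -> M) : Prop :=
  homeomorphism f /\
  forall c d, atlas S c -> atlas S d -> locally_PL c d f.

Definition PL (S : PL_structure) : Type := {f : M -> M | PL_automorphism S f}.

End PLManifold.

Section PLGroup.
Variables (R : realType) (oriented : bool) (n : nat) (M : topologicalType).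
Variable S : PL_structure R oriented n M.

HB.instance Definition _ := gen_eqMixin (PL S).
HB.instance Definition _ := gen_choiceMixin (PL S).

Lemma PL_ext (f g : PL S) : sval f =1 sval g -> f = g.
Proof.
case: f g => f Pf [g Pg] /= /funext fg; case: _ / fg Pg => Pg.
by rewrite (Prop_irrelevance Pf Pg).
Qed.

Lemma PL_automorphism_id : PL_automorphism S id.
Proof.
by split; [exists id; split=> // x; exact: cvg_id | exact: (@atlas_compat _ _ _ _ S)].
Qed.

Lemma PL_automorphism_comp f g :
  PL_automorphism S f -> PL_automorphism S g -> PL_automorphism S (f \o g).
Proof.
move=> [[f' [fK f'K cf cf']] Pf] [[g' [gK g'K cg cg']] Pg]; split.
  exists (g' \o f'); split; [exact: can_comp | exact: can_comp | |].
  - by move=> x; apply: continuous_comp; [exact: cg | exact: cf].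
  - by move=> x; apply: continuous_comp; [exact: cf' | exact: cg'].
move=> c d Sc Sd x cx dx; have [e Se ex] := atlas_cover S (g x).
have [h Ph hE] := Pg c e Sc Se x cx ex.
have [k Pk kE] := Pf e d Se Sd (g x) ex dx.
have kgE : \forall y \near x, d (f (g y)) = k (e (g y)) := cg x _ kE.
exists (k \o h); first exact: PL_cube_comp.
near=> y => /=.
have <- : e (g y) = h (c y) by near: y.
by near: y.
Unshelve. all: by end_near. Qed.

Lemma chart_cube c x : atlas S c -> chart_dom c x -> @cube R n (c x).
Proof. by move=> /atlas_chart[_ [O _ [g [cO _ _ _ _]]]] /cO[]. Qed.

Lemma PL_cube_bij f : @PL_cube R n oriented f ->
  exists g, [/\ set_fun (@cube R n) (@cube R n) f,
    set_fun (@cube R n) (@cube R n) g,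
    {in @cube R n, cancel f g} & {in @cube R n, cancel g f}].
Proof.
elim=> {f} [f [[g [fI gI [fg gf] _ _]] _]||f g _ [f' [f1 f2 f3 f4]] _ [g' [g1 g2 g3 g4]]
    |f g _ [f' [f1 f2 f3 f4]] gI gf].
- by exists g; split.
- by exists id; split.
- exists (g' \o f'); split.
  + by move=> x /g1 /f1.
  + by move=> x /f2 /g2.
  + move=> x xI /=; rewrite f3 ?g3//; move: xI; rewrite !inE; exact: g1.
  + move=> x xI /=; rewrite g4 ?f4//; move: xI; rewrite !inE; exact: f2.
- exists f; split=> // x /set_mem xI.
  have fxI := f1 _ xI; have gfxI := gI _ fxI.
  by rewrite -[LHS]f3 ?inE// gf ?inE// f3 ?inE.
Qed.

Lemma PL_automorphism_inv f g : PL_automorphism S f ->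
  cancel f g -> cancel g f -> PL_automorphism S g.
Proof.
move=> [[g' [fg' g'f cf cg']] Pf] fg gf.
have gE : g = g' by apply/funext => x; rewrite -{1}(g'f x) fg.
subst g'; split; first by exists f.
move=> c d Sc Sd x cx dx.
have fgx : chart_dom c (f (g x)) by rewrite gf.
have [h Ph hE] := Pf d c Sd Sc (g x) dx fgx.
have [k [hI kI hk kh]] := PL_cube_bij Ph.
exists k; first exact: (PL_cube_inv Ph).
have [od _] := atlas_chart Sd.
have dg : \forall y \near x, chart_dom d (g y).
  by apply: (cg' x); exact: open_nbhs_nbhs.
have hgE : \forall y \near x, c (f (g y)) = h (d (g y)) := cg' x _ hE.
near=> y => /=.
have dy : chart_dom d (g y) by near: y.
have yE : c y = h (d (g y)) by rewrite -{1}[y]gf; near: y.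
by rewrite yE hk// inE; exact: (chart_cube Sd).
Unshelve. all: by end_near. Qed.

Definition PL_one : PL S := exist _ _ PL_automorphism_id.

Definition PL_mul (f g : PL S) : PL S :=
  exist _ _ (PL_automorphism_comp (svalP f) (svalP g)).

Definition PL_invfun (f : PL S) : M -> M := sval (cid (proj1 (svalP f))).

Lemma PL_invfunK f : cancel (sval f) (PL_invfun f).
Proof. by rewrite /PL_invfun; case: cid => g []. Qed.

Lemma PL_invfunKV f : cancel (PL_invfun f) (sval f).
Proof. by rewrite /PL_invfun; case: cid => g []. Qed.

Definition PL_inv (f : PL S) : PL S := exist _ _
  (PL_automorphism_inv (svalP f) (@PL_invfunK f) (@PL_invfunKV f)).

Lemma PL_mulA : associative PL_mul.
Proof. by move=> f g h; apply: PL_ext. Qed.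

Lemma PL_mul1 : left_id PL_one PL_mul.
Proof. by move=> f; apply: PL_ext. Qed.

Lemma PL_1mul : right_id PL_one PL_mul.
Proof. by move=> f; apply: PL_ext. Qed.

Lemma PL_mulV : left_inverse PL_one PL_inv PL_mul.
Proof. by move=> f; apply: PL_ext => x /=; rewrite PL_invfunK. Qed.

Lemma PL_Vmul : right_inverse PL_one PL_inv PL_mul.
Proof. by move=> f; apply: PL_ext => x /=; rewrite PL_invfunKV. Qed.

HB.instance Definition _ := isGroup.Build (PL S)
  PL_mulA PL_mul1 PL_1mul PL_mulV PL_Vmul.

End PLGroup.

Definition separable (T : topologicalType) : Prop :=
  exists2 D : set T, countable D & dense D.

Definition completely_metrizable (R : realType) (T : topologicalType) : Prop :=
  exists m : Metric R T, let T' : metricType R := Metric.Pack m in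
    (forall x : T, nbhs x = nbhs (x : T')) /\
    (forall F : set_system T', ProperFilter F -> cauchy F -> exists x : T', F --> x).

Definition polish_group_topology (R : realType) (G : groupType)
    (tau : Topological G) : Prop :=
  let T : topologicalType := Topological.Pack tau in
  [/\ separable T, completely_metrizable R T,
      continuous ((fun p => (p.1 : G) * (p.2 : G))%g : T * T -> T) &
      continuous ((fun x => (x : G)^-1)%g : T -> T)].

Definition admits_polish_group_topology (R : realType) (G : groupType) : Prop :=
  exists tau : Topological G, polish_group_topology R tau.

(* Main.v *)
Require Import Defs.
From mathcomp Require Import all_boot all_order all_algebra.
From mathcomp Require Import all_classical all_reals.
From mathcomp Require Import perm rat archimedean.
From mathcomp Require Import topology normedtype sequences.
From mathcomp Require Import ring lra.

(** Call an element of PL(M) supported in U when it is the identity off U.  Two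
    facts about a Polish topology on PL(M) are used.

    Fixing an open set U pointwise is a closed condition, because it is algebraic:
    f is the identity on U if and only if f commutes with every element supported
    in U ([supported_commute], [commute_fixes]).  If f moves a point of U, it moves
    some open V in U off itself, and cannot commute with a nontrivial element
    supported in V.

    Elements supported in a given nonempty open U accumulate at 1
    ([small_supported]): there are uncountably many of them ([bump_family]), and an
    uncountable subset of a separable group contains distinct f, g with f^-1 g
    arbitrarily close to 1 ([polish_close]).

    Hence, for disjoint open sets U_0, U_1, ..., one can choose f_i supported in
    U_i, nontrivial and fixing a point of U_i, so close to 1 that the products
    f_0 ... f_i form a Cauchy sequence ([polish_product]).  The limit F is an
    element of PL(M), and agrees with f_i on each U_i by the first fact
    ([disjoint_product]).

    The contradiction is that F is too complicated to be PL if the U_i are chosen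
    well.  In a chart they are small balls B_i converging to a point p, such that
    for any finite set of affine maps other than the identity there is, arbitrarily
    far in the sequence, a B_i containing no fixed point of any of them
    ([scattered_avoid]).  Near p, F is given by finitely many affine maps
    ([PL_cube_pieces]).  On a B_i that avoids the fixed points of the nontrivial
    ones, the points fixed by F form a clopen subset; it is not empty since f_i
    fixes a point of B_i, so F is the identity on B_i by connectedness
    ([finite_affine_rigid]), but f_i is not.

    The existence of enough elements of PL(M) needs triangulations.  The cube is
    triangulated by the simplices x_(s 0) >= ... >= x_(s (n-1)), for s a
    permutation ([kuhn_triangulation]); stellar subdivisions, iterated, produce
    triangulations that contain a simplex inside any given open set
    ([small_simplex]).  Starring such a simplex at an interior point and moving
    that point inside the simplex gives a one-parameter family of PL
    homeomorphisms of the cube that are the identity off the simplex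
    ([star_move_pl]); a chart carries them to M, where they extend by the identity
    ([chart_extend_PL]). *)

Set Implicit Arguments.
Unset Strict Implicit.
Unset Printing Implicit Defensive.

Import Order.TTheory GRing.Theory Num.Theory.
Import numFieldNormedType.Exports.

Local Open Scope classical_set_scope.
Local Open Scope ring_scope.

(** * Barycentric coordinates and triangulations *)

Section Barycentric.
Variables (R : realType) (n : nat).
Implicit Types (v u : 'M[R]_(n.+1, n)) (w : 'rV[R]_n.+1) (x p : 'rV[R]_n).

Definition weight w : Prop := (forall i, 0 <= w 0 i) /\ \sum_i w 0 i = 1.

Definition interior_weight w : Prop := (forall i, 0 < w 0 i) /\ \sum_i w 0 i = 1.

Lemma interior_weightW w : interior_weight w -> weight w.
Proof. by case=> w0 w1; split=> // i; exact: ltW. Qed.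

Definition uniform_weight : 'rV[R]_n.+1 := const_mx n.+1%:R^-1.

Lemma uniform_weight_interior : interior_weight uniform_weight.
Proof.
split=> [k|]; first by rewrite mxE invr_gt0 ltr0n.
under eq_bigr do rewrite mxE.
by rewrite sumr_const card_ord -[LHS]mulr_natl mulfV// pnatr_eq0.
Qed.

Lemma simplexP v x : simplex v x <-> exists2 w, weight w & w *m v = x.
Proof.
split=> [[w [w0 w1 _] <-]|[w [w0 w1] <-]]; first by exists w.
by exists w => //; split=> // i; rewrite inE.
Qed.

Lemma mul_const1 w : w *m (const_mx 1 : 'cV[R]_n.+1) = const_mx (\sum_i w 0 i).
Proof.
apply/matrixP => i j; rewrite !mxE ord1.
by apply: eq_bigr => k _; rewrite mxE mulr1.
Qed.

Lemma affinely_independentP v : affinely_independent v <->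
  (forall w, w *m v = 0 -> \sum_i w 0 i = 0 -> w = 0).
Proof.
split=> [|H].
  move=> /row_free_inj inj w wv w1; apply: inj.
  by rewrite mul0mx mul_mx_row wv mul_const1 w1; exact: row_mx0.
apply: inj_row_free => w; rewrite mul_mx_row mul_const1 -row_mx0.
move=> /eq_row_mx[wv /matrixP/(_ 0 0)]; rewrite !mxE => w1; exact: H.
Qed.

Lemma bary_inj v w w' : affinely_independent v ->
  \sum_i w 0 i = \sum_i w' 0 i -> w *m v = w' *m v -> w = w'.
Proof.
move=> /affinely_independentP av s e; apply/eqP; rewrite -subr_eq0; apply/eqP.
apply: av; first by rewrite mulmxBl e subrr.
under eq_bigr do rewrite !mxE.
by rewrite sumrB s subrr.
Qed.

(** Barycentric coordinates.  The vertices of v, extended by a coordinate 1, form an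
    (n+1) x (n + 1) matrix whose two dimensions are not convertible, hence the
    partial inverse instead of [invmx]. *)
Definition bary v x : 'rV[R]_n.+1 :=
  row_mx x (const_mx 1 : 'cV[R]_1) *m pinvmx (row_mx v (const_mx 1 : 'cV[R]_n.+1)).

Lemma baryK v x : affinely_independent v ->
  bary v x *m v = x /\ \sum_i bary v x 0 i = 1.
Proof.
move=> av; set V := row_mx v (const_mx 1 : 'cV[R]_n.+1).
have : bary v x *m V = row_mx x (const_mx 1 : 'cV[R]_1).
  rewrite /bary -/V -mulmxA mulVpmx ?mulmx1//.
  by move: av; rewrite /affinely_independent -/V /row_full /row_free => /eqP ->; rewrite addn1.
rewrite mul_mx_row mul_const1 => /eq_row_mx[-> /matrixP/(_ 0 0)].
by rewrite !mxE.
Qed.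

Lemma bary_mul v w : affinely_independent v -> \sum_i w 0 i = 1 ->
  bary v (w *m v) = w.
Proof.
move=> av w1; apply: (bary_inj av); have [e1 e2] := baryK (w *m v) av.
  by rewrite e2 w1.
by rewrite e1.
Qed.

Lemma simplex_bary v x : affinely_independent v ->
  simplex v x <-> forall i, 0 <= bary v x 0 i.
Proof.
move=> av; have [e1 e2] := baryK x av; rewrite simplexP; split.
  by move=> [w [w0 w1] <-]; rewrite bary_mul.
by move=> b0; exists (bary v x).
Qed.

Lemma delta_weight (k : 'I_n.+1) : weight (delta_mx 0 k).
Proof.
split=> [i|]; first by rewrite mxE ler0n.
rewrite (bigD1 k)//= mxE !eqxx big1 ?addr0// => i ik.
by rewrite mxE (negbTE ik) andbF.
Qed.

Lemma row_inj v : affinely_independent v -> injective (fun k => row k v).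
Proof.
move=> av k l; rewrite !rowE => /(bary_inj av).
rewrite (delta_weight k).2 (delta_weight l).2 => /(_ erefl)/matrixP/(_ 0 l).
by rewrite !mxE !eqxx /=; case: eqVneq => // _ /eqP; rewrite eq_sym oner_eq0.
Qed.

(** A point of a face of u whose vertices are all vertices of v has weights in v too:
    the weights are carried by the matching [phi] of the vertices. *)
Lemma push_weight u v w (phi : 'I_n.+1 -> 'I_n.+1) : weight w ->
  (forall k, w 0 k != 0 -> row k u = row (phi k) v) ->
  let w' := \row_l \sum_(k | phi k == l) w 0 k in
  weight w' /\ w *m u = w' *m v.
Proof.
move=> [w0 w1] uv w'; split; first split.
- by move=> l; rewrite mxE sumr_ge0.
- rewrite -w1 [RHS](partition_big phi xpredT)//=.
  by apply: eq_bigr => l _; rewrite mxE.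
- rewrite !mulmx_sum_row [LHS](partition_big phi xpredT)//=.
  apply: eq_bigr => l _; rewrite mxE scaler_suml.
  apply: eq_bigr => k /eqP <-; have [->|/uv ->//] := eqVneq (w 0 k) 0.
  by rewrite !scale0r.
Qed.

Lemma row_simplex u k : simplex u (row k u).
Proof. by apply/simplexP; exists (delta_mx 0 k); [exact: delta_weight|rewrite -rowE]. Qed.

(** The vertices of u that are also vertices of v span the face that u should have in
    common with v. *)
Definition share u v (k : 'I_n.+1) : bool := [exists l, row k u == row l v].

Lemma shareP u v k : reflect (exists l, row k u = row l v) (share u v k).
Proof. by apply: (iffP existsP) => -[l /eqP]; exists l => //; apply/eqP. Qed.

Lemma face_share u v :
  face u [set k | share u v k]%SET `<=` face v [set k | share v u k]%SET.
Proof.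
move=> _ [w [w0 w1 ws] <-].
pose phi k := odflt k [pick l | row k u == row l v].
have phiP k : w 0 k != 0 -> row k u = row (phi k) v.
  move=> wk; have : share u v k.
    by apply: contraNT wk => nk; rewrite ws// inE.
  move=> /existsP[l kl]; rewrite /phi; case: pickP => [? /eqP//|/(_ l)].
  by rewrite kl.
have [[w'0 w'1] ->] := push_weight (conj w0 w1) phiP.
exists (\row_l \sum_(k | phi k == l) w 0 k) => //; split=> // l.
rewrite inE => /shareP nl; rewrite mxE big1// => k /eqP kl.
apply/eqP/negPn/negP => /phiP; rewrite kl => e; apply: nl; by exists k.
Qed.

Lemma share_pos u v w w' k : affinely_independent v -> weight w -> weight w' ->
  (forall k, w 0 k != 0 -> share u v k) -> w *m u = w' *m v -> w 0 k != 0 ->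
  exists l, row k u = row l v /\ w' 0 l != 0.
Proof.
move=> av ww ww' uv e wk.
pose phi k := odflt k [pick l | row k u == row l v].
have phiP j : w 0 j != 0 -> row j u = row (phi j) v.
  move=> /uv /existsP[l kl]; rewrite /phi; case: pickP => [? /eqP//|/(_ l)].
  by rewrite kl.
have [wp pe] := push_weight ww phiP.
exists (phi k); split; first exact: phiP.
have -> : w' = \row_l \sum_(k | phi k == l) w 0 k.
  by apply: (bary_inj av); rewrite ?wp.2 ?ww'.2// -pe.
rewrite mxE (bigD1 k)//= gt_eqF// ltr_pwDl ?lt_neqAle 1?eq_sym ?wk ?ww.1//.
by apply: sumr_ge0 => j _; exact: ww.1.
Qed.

(** A form of [subdivision] that is stable under stellar subdivision.  The common face
    of two simplices is pinned down as the one spanned by their common vertices;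
    [tri_sep] excludes that a simplex occurs twice with its vertices permuted, in
    which case starring one copy would leave the other in place. *)
Record triangulation (K : seq 'M[R]_(n.+1, n)) : Prop := Triangulation {
  tri_indep : forall v, v \in K -> affinely_independent v;
  tri_cube : forall v x, v \in K -> simplex v x -> cube x;
  tri_cover : forall x, cube x -> exists2 v, v \in K & simplex v x;
  tri_share : forall u v w, u \in K -> v \in K -> weight w ->
     simplex v (w *m u) -> forall k, w 0 k != 0 -> share u v k;
  tri_sep : forall u v, u \in K -> v \in K -> u <> v -> exists k, ~~ share u v k }.

Lemma face_simplex v a : face v a `<=` simplex v.
Proof. by move=> x [w [w0 w1 _] <-]; apply/simplexP; exists w. Qed.

Lemma triangulation_subdivision K : triangulation K -> subdivision K.
Proof.
move=> tK; split.
- by apply/allP => v; exact: tri_indep.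
- apply/seteqP; split=> x; first by move=> [v /= vK vx]; exact: (tri_cube tK vK).
  by move=> /(tri_cover tK)[v vK vx]; exists v.
move=> u v uK vK.
exists [set k | share u v k]%SET, [set k | share v u k]%SET.
have uv : face u [set k | share u v k]%SET = face v [set k | share v u k]%SET.
  by apply/seteqP; split; exact: face_share.
split=> //; apply/seteqP; split=> x.
  move=> [/simplexP[w [w0 w1] <-] vx]; exists w => //; split=> // k.
  rewrite inE => ns; apply/eqP; apply: contraNT ns => wk.
  exact: (tri_share tK uK vK (conj w0 w1) vx).
by move=> ux; split; [|rewrite uv in ux]; exact: (face_simplex ux).
Qed.

End Barycentric.

(** * Stellar subdivision at an interior point *)

Section Star.
Variables (R : realType) (n : nat).
Implicit Types (v u : 'M[R]_(n.+1, n)) (w pi : 'rV[R]_n.+1) (x p : 'rV[R]_n).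

(** Joining p to the facet of v opposite to its i-th vertex; p takes the i-th place, so
    that weights of the two simplices can be compared index by index. *)
Definition star v p (i : 'I_n.+1) : 'M[R]_(n.+1, n) :=
  \matrix_(k, j) (if k == i then p 0 j else v k j).

(** The weights in v of the point with weights w in [star v (pi *m v) i]. *)
Definition star_weight pi (i : 'I_n.+1) w : 'rV[R]_n.+1 :=
  \row_k ((k != i)%:R * w 0 k + w 0 i * pi 0 k).

Lemma row_star v p i k : row k (star v p i) = if k == i then p else row k v.
Proof. by apply/rowP => j; rewrite !mxE; case: eqP => //; rewrite mxE. Qed.

Lemma mul_star v pi i w : w *m star v (pi *m v) i = star_weight pi i w *m v.
Proof.
have -> : star_weight pi i w = \row_k ((k != i)%:R * w 0 k) + w 0 i *: pi.
  by apply/rowP => k; rewrite !mxE.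
rewrite mulmxDl -scalemxAl !mulmx_sum_row (bigD1 i)//= row_star eqxx addrC.
congr (_ + _); rewrite [RHS](bigD1 i)//= mxE eqxx mul0r scale0r add0r.
by apply: eq_bigr => k ki; rewrite row_star (negbTE ki) mxE ki mul1r.
Qed.

Lemma sum_star_weight pi i w : \sum_k pi 0 k = 1 ->
  \sum_k star_weight pi i w 0 k = \sum_k w 0 k.
Proof.
move=> pi1; under eq_bigr do rewrite mxE.
rewrite big_split/= -mulr_sumr pi1 mulr1 [RHS](bigD1 i)//= addrC; congr (_ + _).
rewrite (bigD1 i)//= eqxx mul0r add0r.
by apply: eq_bigr => k ->; rewrite mul1r.
Qed.

Lemma star_weight_weight pi i w : weight pi -> weight w -> weight (star_weight pi i w).
Proof.
move=> [pi0 pi1] [w0 w1]; split; last by rewrite sum_star_weight.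
by move=> k; rewrite mxE addr_ge0// mulr_ge0.
Qed.

Lemma star_indep v pi i : affinely_independent v -> \sum_k pi 0 k = 1 ->
  pi 0 i != 0 -> affinely_independent (star v (pi *m v) i).
Proof.
move=> /affinely_independentP av pi1 pii; apply/affinely_independentP => w.
rewrite mul_star => /av + w1; rewrite sum_star_weight// => /(_ w1) /rowP e.
have wi : w 0 i = 0.
  have /eqP := e i; rewrite !mxE eqxx mul0r add0r mulf_eq0 (negbTE pii) orbF.
  by move=> /eqP.
apply/rowP => k; have [->|ki] := eqVneq k i; first by rewrite wi mxE.
by have := e k; rewrite !mxE ki mul1r wi mul0r addr0.
Qed.

Lemma star_simplex v pi i : weight pi ->
  simplex (star v (pi *m v) i) `<=` simplex v.
Proof.
move=> wpi x /simplexP[w ww <-]; apply/simplexP; exists (star_weight pi i w).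
  exact: star_weight_weight.
by rewrite mul_star.
Qed.

(** A point x of the simplex lies in the part opposite to the facet i where the ratio
    between the i-th weight of x and that of the apex is least: removing this multiple
    of the apex from x keeps all the weights nonnegative. *)
Lemma star_cover v pi x : interior_weight pi ->
  simplex v x -> exists i, simplex (star v (pi *m v) i) x.
Proof.
move=> [pi0 pi1] /simplexP[w [w0 w1] <-].
pose i := [arg min_(i < ord0) (w 0 i / pi 0 i)]%O.
have imin k : w 0 i / pi 0 i <= w 0 k / pi 0 k.
  by rewrite /i; case: Order.TotalTheory.arg_minP => // i0 _; exact.
exists i; set t := w 0 i / pi 0 i in imin.
pose w' : 'rV[R]_n.+1 := \row_k if k == i then t else w 0 k - t * pi 0 k.
have ww' : star_weight pi i w' = w.
  apply/rowP => k; rewrite !mxE eqxx; case: eqVneq => [->|ki] /=.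
    by rewrite mul0r add0r /t divfK// gt_eqF.
  by rewrite mul1r subrK.
apply/simplexP; exists w'; last by rewrite mul_star ww'.
split; last by rewrite -(@sum_star_weight pi i) ?ww'.
move=> k; rewrite mxE; case: eqVneq => [ki|ki].
  by rewrite divr_ge0// ltW.
by rewrite subr_ge0 -ler_pdivlMr.
Qed.

Definition star_subdiv (K : seq 'M[R]_(n.+1, n)) v p :=
  [seq u <- K | u != v] ++ [seq star v p i | i <- enum 'I_n.+1].

Variables (K : seq 'M[R]_(n.+1, n)) (v : 'M[R]_(n.+1, n)) (pi : 'rV[R]_n.+1).
Hypotheses (tK : triangulation K) (vK : v \in K).
Hypothesis ipi : interior_weight pi.
Let p := pi *m v.

Let pi0 k : 0 < pi 0 k. Proof. exact: ipi.1. Qed.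
Let pi1 : \sum_k pi 0 k = 1. Proof. exact: ipi.2. Qed.
Let wpi : weight pi. Proof. exact: interior_weightW. Qed.
Let av : affinely_independent v := tri_indep tK vK.

(** A simplex u of K other than v misses a vertex of v, so a point of v that belongs to
    u has weight 0 there; but every vertex of v gets a positive contribution from the
    apex. *)
Lemma star_apex_weight0 u i w : u \in K -> u <> v -> weight w ->
  simplex u (w *m star v p i) -> w 0 i = 0.
Proof.
move=> uK uv ww; have wsw := star_weight_weight i wpi ww.
rewrite mul_star => us.
have [l nl] := tri_sep tK vK uK (fun e => uv (esym e)).
have : star_weight pi i w 0 l = 0.
  by apply/eqP; apply: contraNT nl => /(tri_share tK vK uK wsw us).
rewrite mxE => /eqP; rewrite paddr_eq0 ?mulr_ge0 ?ww.1// ?(ltW (pi0 _))//.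
by move=> /andP[_]; rewrite mulf_eq0 (gt_eqF (pi0 l)) orbF => /eqP.
Qed.

Lemma star_apex_notin u : u \in K -> u <> v -> ~ simplex u p.
Proof.
move=> uK uv up; have := @star_apex_weight0 u ord0 (delta_mx 0 0) uK uv (delta_weight _ _).
by rewrite -rowE row_star eqxx mxE !eqxx => /(_ up)/eqP; rewrite oner_eq0.
Qed.

Lemma star_apex_neq_row k l : k != l -> row k v <> p.
Proof.
move=> kl; rewrite rowE => /(bary_inj av).
rewrite pi1 (delta_weight _ k).2 => /(_ erefl)/rowP/(_ l).
rewrite mxE eqxx/= eq_sym (negbTE kl) => /eqP.
by rewrite eq_sym gt_eqF.
Qed.

Lemma mem_star_subdiv u : u \in star_subdiv K v p <->
  (u \in K /\ u <> v) \/ exists i, u = star v p i.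
Proof.
rewrite mem_cat mem_filter; split.
  move=> /orP[/andP[/eqP]|/mapP[i _ ->]]; first by left.
  by right; exists i.
case=> [[-> /eqP ->]//|[i ->]]; apply/orP; right.
by apply/mapP; exists i => //; rewrite mem_enum.
Qed.

Lemma star_triangulation : triangulation (star_subdiv K v p).
Proof.
split.
- move=> u /mem_star_subdiv[[uK _]|[i ->]]; first exact: (tri_indep tK).
  by apply: star_indep => //; rewrite gt_eqF.
- move=> u x /mem_star_subdiv[[uK _]|[i ->]]; first exact: (tri_cube tK).
  by move=> /(star_simplex wpi); exact: (tri_cube tK).
- move=> x /(tri_cover tK)[u uK ux]; have [uv|uv] := eqVneq u v; last first.
    by exists u => //; apply/mem_star_subdiv; left; split=> //; exact/eqP.
  move: ux; rewrite uv => /(star_cover ipi)[i xi].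
  by exists (star v p i) => //; apply/mem_star_subdiv; right; exists i.
- move=> u1 u2 w /mem_star_subdiv[[uK uv]|[i ->]] /mem_star_subdiv[[u'K u'v]|[j ->]] ww.
  + exact: (tri_share tK).
  + move=> xj k wk; have xv := star_simplex wpi xj.
    have /simplexP[w' ww' we] := xj.
    have w'j : w' 0 j = 0.
      by apply: (star_apex_weight0 uK uv ww'); rewrite we; apply/simplexP; exists w.
    rewrite mul_star in we.
    have [l [kl]] := share_pos av ww (star_weight_weight j wpi ww')
      (tri_share tK uK vK ww xv) (esym we) wk.
    rewrite mxE w'j mul0r addr0 mulf_eq0 negb_or pnatr_eq0 eqb0 negbK => /andP[lj _].
    by apply/shareP; exists l; rewrite row_star (negbTE lj).
  + move=> xu k wk; have wi := star_apex_weight0 u'K u'v ww xu.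
    have ki : k != i by apply: contraNneq wk => ->; exact/eqP.
    rewrite mul_star in xu.
    have /shareP[l kl] := tri_share tK vK u'K (star_weight_weight i wpi ww) xu
      (k := k) ltac:(by rewrite mxE ki mul1r wi mul0r addr0).
    by apply/shareP; exists l; rewrite row_star (negbTE ki).
  + move=> /simplexP[w' ww' e] k wk.
    have [ij|ij] := eqVneq i j; first by apply/shareP; exists k; rewrite ij.
    rewrite !mul_star in e.
    have /rowP ee : star_weight pi j w' = star_weight pi i w.
      by apply: (bary_inj av) => //; rewrite !sum_star_weight// ww.2 ww'.2.
    (* comparing the weights at the vertices i and j of v *)
    have wj : w 0 j = 0.
      have := esym (ee i); have := esym (ee j).
      rewrite !mxE !eqxx ij eq_sym ij !mul0r !mul1r !add0r => ej ei.
      have le1 : w 0 i <= w' 0 j.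
        by rewrite -(ler_pM2r (pi0 j)) -ej lerDr; exact: ww.1.
      have le2 : w' 0 j <= w 0 i.
        by rewrite -(ler_pM2r (pi0 i)) ei lerDr; exact: ww'.1.
      have ww_ij : w 0 i = w' 0 j by apply/eqP; rewrite eq_le le1.
      by apply: (addIr (w 0 i * pi 0 j)); rewrite ej ww_ij add0r.
    have kj : k != j by apply: contraNneq wk => ->; exact/eqP.
    have [ki|ki] := eqVneq k i.
      by apply/shareP; exists j; rewrite !row_star ki !eqxx.
    by apply/shareP; exists k; rewrite !row_star (negbTE ki) (negbTE kj).
- move=> u1 u2 /mem_star_subdiv[[uK uv]|[i ->]] /mem_star_subdiv[[u'K u'v]|[j ->]] uu'.
  + exact: (tri_sep tK).
  + have [k nk] := tri_sep tK uK vK uv; exists k; apply: contraNN nk => /shareP[l].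
    rewrite row_star; case: eqVneq => [_ kp|_ kl]; last by apply/shareP; exists l.
    by case: (star_apex_notin uK uv); rewrite -kp; exact: row_simplex.
  + exists i; apply/negP => /shareP[l]; rewrite row_star eqxx => pl.
    by case: (star_apex_notin u'K u'v); rewrite pl; exact: row_simplex.
  + have ij : j != i by apply/eqP => ij; apply: uu'; rewrite ij.
    exists j; apply/negP => /shareP[l]; rewrite !row_star (negbTE ij).
    case: eqVneq => [_|lj /(row_inj av) jl]; first exact: star_apex_neq_row ij.
    by rewrite jl eqxx in lj.
Qed.

End Star.

(** * Triangulations with small simplices *)

Section Shrink.
Variables (R : realType) (n : nat).
Implicit Types (K : seq 'M[R]_(n.+1, n)) (v : 'M[R]_(n.+1, n)) (pi : 'rV[R]_n.+1).

(** The simplex v with its k-th vertex brought closer to q by the factor [e k]. *)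
Definition pull v (q : 'rV[R]_n) (e : 'I_n.+1 -> R) : 'M[R]_(n.+1, n) :=
  \matrix_(k, j) ((1 - e k) * q 0 j + e k * v k j).

Lemma row_pull v q e k : row k (pull v q e) = (1 - e k) *: q + e k *: row k v.
Proof. by apply/rowP => j; rewrite !mxE. Qed.

Lemma mul_pull v q e (w : 'rV[R]_n.+1) :
  w *m pull v q e = (\sum_k w 0 k * (1 - e k)) *: q + (\row_k (w 0 k * e k)) *m v.
Proof.
rewrite !mulmx_sum_row scaler_suml -big_split/=; apply: eq_bigr => k _.
by rewrite row_pull scalerDr !scalerA mxE.
Qed.

Lemma pull_center v pi e : interior_weight pi -> (forall k, 0 < e k) ->
  exists2 rho, interior_weight rho & rho *m pull v (pi *m v) e = pi *m v.
Proof.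
move=> [pi0 pi1] e0; set s := \sum_k pi 0 k / e k.
have s0 : 0 < s.
  rewrite /s (bigD1 ord0)//= ltr_pwDl ?divr_gt0// sumr_ge0// => i _.
  by rewrite ltW// divr_gt0.
have s_neq0 : s != 0 by rewrite gt_eqF.
pose rho : 'rV[R]_n.+1 := \row_k (s^-1 * (pi 0 k / e k)).
have rho1 : \sum_k rho 0 k = 1.
  by under eq_bigr do rewrite mxE; rewrite -mulr_sumr mulVf.
have rhoe k : rho 0 k * e k = s^-1 * pi 0 k.
  by rewrite mxE -mulrA divfK// gt_eqF.
exists rho; first by split=> // k; rewrite mxE mulr_gt0 ?invr_gt0 ?divr_gt0.
rewrite mul_pull.
have -> : \row_k (rho 0 k * e k) = s^-1 *: pi.
  by apply/rowP => k; rewrite !mxE -rhoe mxE.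
under eq_bigr do rewrite mulrBr mulr1 rhoe.
rewrite sumrB rho1 -mulr_sumr pi1 mulr1 -scalemxAl scalerBl scale1r.
by rewrite subrK.
Qed.

(** Replacing the vertices one after the other by points near q is a sequence of
    stellar subdivisions: q remains interior to the simplices met on the way, hence so
    is any point between q and a vertex.  In the end the whole simplex has been shrunk
    towards q. *)
Lemma shrink_triangulation K v pi (e : R) : triangulation K -> v \in K ->
  interior_weight pi -> 0 < e <= 1 ->
  exists2 K', triangulation K' & pull v (pi *m v) (fun=> e) \in K'.
Proof.
move=> tK vK ipi /andP[e0 e1]; set q := pi *m v.
(* after m steps, the first m vertices have been moved *)
pose em m (k : 'I_n.+1) := if (k < m)%N then e else 1.
have em0 m k : 0 < em m k by rewrite /em; case: ifP.
suff H m : (m <= n.+1)%N -> exists2 K', triangulation K' & pull v q (em m) \in K'.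
  have [K' tK' vK'] := H n.+1 (leqnn _); exists K' => //.
  rewrite (_ : pull v q _ = pull v q (em n.+1))//.
  by apply/matrixP => k j; rewrite !mxE /em ltn_ord.
elim: m => [_|m IH mn].
  exists K => //; rewrite (_ : pull _ _ _ = v)//.
  by apply/matrixP => k j; rewrite !mxE /em ltn0 subrr mul0r add0r mul1r.
have [K' tK' vK'] := IH (ltnW mn).
have [rho [rho0 rho1] rhoq] := pull_center v ipi (em0 m).
pose i := Ordinal mn.
(* the weights of the new apex in the simplex to be starred *)
pose tau : 'rV[R]_n.+1 := (1 - e) *: rho + e *: delta_mx 0 i.
have tauE k : tau 0 k = (1 - e) * rho 0 k + e * (k == i)%:R by rewrite !mxE eqxx.
move: e1; rewrite le_eqVlt => /orP[/eqP e1|e1].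
  exists K' => //; rewrite (_ : pull _ _ _ = pull v q (em m))//.
  by apply/matrixP => k j; rewrite !mxE /em e1 !if_same.
have tau0 k : 0 < tau 0 k.
  by rewrite tauE ltr_pwDl ?mulr_gt0 ?subr_gt0// mulr_ge0 ?ler0n// ltW.
have tau1 : \sum_k tau 0 k = 1.
  under eq_bigr do rewrite tauE.
  rewrite big_split/= -!mulr_sumr rho1 mulr1.
  rewrite (bigD1 i)//= eqxx big1 ?addr0 ?mulr1 ?subrK// => k /negbTE ->//.
exists (star_subdiv K' (pull v q (em m)) (tau *m pull v q (em m))).
  exact: star_triangulation.
apply/mem_star_subdiv; right; exists i; apply/row_matrixP => k.
rewrite row_star !row_pull /em ltnS; case: eqVneq => [->|ki].
  rewrite leqnn mulmxDl -!scalemxAl rhoq -rowE row_pull /em ltnn.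
  by rewrite subrr scale0r add0r scale1r.
have km : (k == m :> nat) = false.
  by apply/negbTE; apply: contraNneq ki => km; apply/eqP/val_inj.
by rewrite leq_eqVlt km.
Qed.

End Shrink.

(** The two products, in either order, of the block matrices [1, -d; u, 1] and
    [1, 0; -u, 1] are block triangular, with the two sides as determinants. *)
Lemma det_1Dmul (R : comPzRingType) n (u : 'cV[R]_n) (d : 'rV[R]_n) :
  \det (1%:M + u *m d) = 1 + (d *m u) 0 0.
Proof.
pose B := block_mx (1%:M : 'M[R]_1) (- d) u (1%:M : 'M[R]_n).
pose C := block_mx (1%:M : 'M[R]_1) 0 (- u) (1%:M : 'M[R]_n).
have detC : \det C = 1 by rewrite det_lblock !det1 mulr1.
have : \det (C *m B) = \det (B *m C) by rewrite !det_mulmx mulrC.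
rewrite !mulmx_block !mul1mx !mulmx1 !mul0mx !mulmx0 !mulNmx !mulmxN !opprK.
rewrite !add0r ?addr0 addNr subrr.
rewrite det_ublock det_ublock !det1 mul1r mulr1 addrC => ->.
by rewrite det_mx11 !mxE eqxx.
Qed.

(** * Moving the apex of a stellar subdivision *)

Section StarMove.
Variables (R : realType) (n : nat) (v : 'M[R]_(n.+1, n)).
Hypothesis av : affinely_independent v.
Implicit Types (pi : 'rV[R]_n.+1) (x : 'rV[R]_n).

(** The function equal to 1 at the point with weights pi, to 0 on the boundary and off
    the simplex v, and affine on each simplex of the star of that point.  The minimum may
    start from 1 because the ratios cannot all exceed 1. *)
Definition peak pi x : R :=
  Num.max 0 (\big[Num.min/1]_i (bary v x 0 i / pi 0 i)).

(** Moves the apex with weights pi to the one with weights pi', linearly on each simplex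
    of the star. *)
Definition star_move pi pi' x : 'rV[R]_n := x + peak pi x *: ((pi' - pi) *m v).

Lemma peak_out pi x i : interior_weight pi -> bary v x 0 i <= 0 -> peak pi x = 0.
Proof.
move=> [p0 _] xi; apply/eqP; rewrite eq_le le_max lexx/= andbT ge_max lexx/=.
by apply: le_trans (bigmin_le _ i _) _; rewrite ler_pdivrMr// mul0r.
Qed.

Lemma peak_star pi w i : interior_weight pi -> weight w ->
  peak pi (w *m star v (pi *m v) i) = w 0 i.
Proof.
move=> ip [w0 w1]; have [p0 p1] := ip.
have bE : bary v (w *m star v (pi *m v) i) = star_weight pi i w.
  by rewrite mul_star bary_mul// sum_star_weight.
have minE : \big[Num.min/1]_k (bary v (w *m star v (pi *m v) i) 0 k / pi 0 k) = w 0 i.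
  apply/eqP; rewrite eq_le bE; apply/andP; split.
    apply: le_trans (bigmin_le _ i _) _.
    by rewrite mxE eqxx mul0r add0r mulfK// gt_eqF.
  apply/bigmin_geP; split=> [|k _].
    by rewrite -w1 (bigD1 i)//= lerDl sumr_ge0.
  by rewrite ler_pdivlMr// mxE lerDr mulr_ge0.
by rewrite /peak minE max_r.
Qed.

Lemma star_move_star pi pi' w i : interior_weight pi -> weight w ->
  star_move pi pi' (w *m star v (pi *m v) i) = w *m star v (pi' *m v) i.
Proof.
move=> ip ww; rewrite /star_move peak_star// !mul_star scalemxAl -mulmxDl.
congr (_ *m _); apply/rowP => k; rewrite !mxE; ring.
Qed.

Lemma star_move_out pi pi' x i : interior_weight pi -> bary v x 0 i <= 0 ->
  star_move pi pi' x = x.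
Proof. by move=> ip xi; rewrite /star_move (peak_out ip xi) scale0r addr0. Qed.

Lemma not_simplexP x : ~ simplex v x -> exists i, bary v x 0 i <= 0.
Proof.
move=> nx; apply: contrapT => H; apply: nx; apply/simplex_bary => // i.
by rewrite leNgt; apply/negP => xi; apply: H; exists i; exact: ltW.
Qed.

Lemma star_move_notin pi pi' x : interior_weight pi -> ~ simplex v x ->
  star_move pi pi' x = x.
Proof. by move=> ip /not_simplexP[i]; exact: star_move_out. Qed.

(** On each simplex of the star, moving the apex changes the vertices and keeps the
    weights, so it is undone by moving the apex back. *)
Lemma star_moveK pi pi' : interior_weight pi -> interior_weight pi' ->
  cancel (star_move pi pi') (star_move pi' pi).
Proof.
move=> ip ip' x; have [xv|xv] := pselect (simplex v x); last first.
  by rewrite [X in star_move _ _ X]star_move_notin// star_move_notin.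
have [i /simplexP[w ww <-]] := star_cover ip xv.
by rewrite star_move_star// star_move_star.
Qed.

Lemma star_move_simplex pi pi' x : interior_weight pi -> interior_weight pi' ->
  simplex v x -> simplex v (star_move pi pi' x).
Proof.
move=> ip ip' xv; have [i /simplexP[w ww <-]] := star_cover ip xv.
rewrite star_move_star//; apply: (star_simplex (interior_weightW ip') (i := i)).
by apply/simplexP; exists w.
Qed.

Lemma star_move_apex pi pi' : interior_weight pi ->
  star_move pi pi' (pi *m v) = pi' *m v.
Proof.
move=> ip; have -> : pi *m v = delta_mx 0 0 *m star v (pi *m v) 0.
  by rewrite -rowE row_star eqxx.
rewrite star_move_star//; last exact: delta_weight.
by rewrite -rowE row_star eqxx.
Qed.

Definition bary_lin : 'M[R]_(n, n.+1) :=
  usubmx (pinvmx (row_mx v (const_mx 1 : 'cV[R]_n.+1))).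

Definition bary_cst : 'rV[R]_n.+1 :=
  dsubmx (pinvmx (row_mx v (const_mx 1 : 'cV[R]_n.+1))).

Lemma baryE x : bary v x = x *m bary_lin + bary_cst.
Proof.
rewrite /bary -{1}[pinvmx _]vsubmxK mul_row_col; congr (_ + _).
by apply/rowP => k; rewrite mxE big_ord1 [const_mx _ _ _]mxE mul1r.
Qed.

Lemma bary_continuous i : continuous (fun x => bary v x 0 i : R^o).
Proof.
have -> : (fun x => bary v x 0 i) =
    (fun x => \sum_j x 0 j * bary_lin j i + bary_cst 0 i).
  by apply/funext => x; rewrite baryE mxE [X in X + _]mxE.
move=> x; apply: (@continuousD R R^o 'rV[R]_n
  (fun x => \sum_j x 0 j * bary_lin j i) (fun=> bary_cst 0 i)); last exact: cst_continuous.
apply: (@continuous_big R^o _ +%R 0 xpredT add_continuous 'rV[R]_n _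
  (fun j x => x 0 j * bary_lin j i)) => j _ y.
apply: (@continuousM _ _ (fun x : 'rV[R]_n => x 0 j) (fun=> bary_lin j i)).
  exact: coord_continuous.
exact: cst_continuous.
Qed.

Lemma simplex_closed : closed (simplex v).
Proof.
have -> : simplex v =
    \bigcap_(i in [set: 'I_n.+1]) ((fun x => bary v x 0 i) @^-1` [set t : R | 0 <= t]).
  apply/seteqP; split=> x; first by move=> /(simplex_bary _ av) H i _; exact: H.
  by move=> H; apply/simplex_bary => // i; exact: H.
apply: closed_bigI => i _; apply: preimage_closed; last exact: closed_ge.
by move=> x _; exact: bary_continuous.
Qed.

Lemma simplex_nbhs pi : interior_weight pi -> nbhs (pi *m v) (simplex v).
Proof.
move=> ip; have pos i : \forall z \near pi *m v, 0 < bary v z 0 i.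
  have pos_pi : nbhs (bary v (pi *m v) 0 i) [set t : R | 0 < t].
    apply: open_nbhs_nbhs; split; first exact: open_gt.
    by rewrite /= bary_mul ?ip.2// ip.1.
  have := @bary_continuous i (pi *m v) _ pos_pi; exact.
apply: (@filterS _ _ _ _ _ _ (@filter_forall _ _ _ (nbhs (pi *m v)) _ pos)) => z z0.
by apply/simplex_bary => // i; exact: ltW.
Qed.

Lemma peak_continuous pi : continuous (peak pi : 'rV[R]_n -> R^o).
Proof.
move=> x; apply: (@continuous_max R _ (fun=> 0)); first exact: cst_continuous.
have min_cts : continuous (fun z : R^o * R^o => Num.min z.1 z.2 : R^o).
  by move=> z; apply: (@continuous_min R _ fst snd); [exact: cvg_fst|exact: cvg_snd].
apply: (@continuous_big R^o _ Num.min 1 xpredT min_cts 'rV[R]_n _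
  (fun j x => bary v x 0 j / pi 0 j)) => j _ y.
apply: (@continuousM _ _ (fun x : 'rV[R]_n => bary v x 0 j) (fun=> (pi 0 j)^-1)).
  exact: bary_continuous.
exact: cst_continuous.
Qed.

Lemma star_move_continuous pi pi' : continuous (star_move pi pi').
Proof.
move=> x.
apply: (@continuousD _ _ 'rV[R]_n id (fun x => peak pi x *: ((pi' - pi) *m v))).
  exact: cvg_id.
apply: (@continuousZr_tmp _ _ _ (peak pi) ((pi' - pi) *m v)); exact: peak_continuous.
Qed.

(** The piece is x + l(x) d, with l the i-th barycentric coordinate divided by
    pi_i and d the displacement of the apex; its determinant is 1 plus the linear part
    of l at d, that is pi'_i / pi_i. *)
Lemma star_move_affine pi pi' i : interior_weight pi -> interior_weight pi' ->
  exists (A : 'M[R]_n) (b : 'rV[R]_n), 0 < \det A /\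
    forall x, simplex (star v (pi *m v) i) x -> star_move pi pi' x = x *m A + b.
Proof.
move=> ip ip'; pose d := (pi' - pi) *m v; pose c := (pi 0 i)^-1.
exists (1%:M + (c *: col i bary_lin) *m d), ((c * bary_cst 0 i) *: d); split.
  have dl : d *m bary_lin = pi' - pi.
    have := baryE (pi *m v); have := baryE (pi' *m v).
    rewrite !bary_mul ?ip.2 ?ip'.2// => e' e.
    rewrite [X in _ = X - _]e' [X in _ = _ - X]e opprD addrACA subrr addr0.
    by rewrite /d !mulmxBl.
  rewrite det_1Dmul -scalemxAr colE mulmxA dl -colE !mxE /c mulrBr mulVf ?gt_eqF ?ip.1//.
  by rewrite addrC subrK mulr_gt0 ?invr_gt0 ?ip.1 ?ip'.1.
move=> x /simplexP[w ww <-]; set y := w *m _.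
have -> : star_move pi pi' y = y + (bary v y 0 i * c) *: d.
  rewrite /star_move /y peak_star// mul_star bary_mul ?sum_star_weight ?ip.2 ?ww.2//.
  by rewrite mxE eqxx mul0r add0r mulfK// gt_eqF ?ip.1.
rewrite baryE mulmxDr mulmx1 -addrA; congr (_ + _).
clearbody d; have mulE (z : 'cV[R]_1) : z *m d = z 0 0 *: d.
  by rewrite mulmx_sum_row big_ord1 row_id.
have -> : y *m ((c *: col i bary_lin) *m d) = (c * (y *m bary_lin) 0 i) *: d.
  rewrite mulmxA mulE -scalemxAr colE mulmxA -colE; congr (_ *: _).
  by move: (y *m bary_lin) => z; rewrite !mxE.
rewrite -scalerDl; congr (_ *: _).
by move: (y *m bary_lin) => z; rewrite mxE mulrC mulrDr.
Qed.

Lemma star_move_pl (o : bool) (K : seq 'M[R]_(n.+1, n)) pi pi' :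
  triangulation K -> v \in K -> interior_weight pi -> interior_weight pi' ->
  pl_homeo_cube o (star_move pi pi').
Proof.
move=> tK vK ip ip'.
have cI p p' : interior_weight p -> interior_weight p' ->
    set_fun (@cube R n) (@cube R n) (star_move p p').
  move=> ipp ipp' x xI; have [xv|xv] := pselect (simplex v x).
    by apply: (tri_cube tK vK); exact: star_move_simplex.
  by rewrite star_move_notin.
split.
  exists (star_move pi' pi); split; [exact: cI|exact: cI| | |].
  - by split=> x _; exact: star_moveK.
  - exact/continuous_subspaceT/star_move_continuous.
  - exact/continuous_subspaceT/star_move_continuous.
exists (star_subdiv K v (pi *m v)).
  by apply/triangulation_subdivision/star_triangulation.
move=> u /mem_star_subdiv[[uK uv]|[i ->]].
  exists 1%:M, 0; rewrite det1 ltr01 oner_neq0 if_same; split=> // x xu.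
  rewrite mulmx1 addr0; have [xv|xv] := pselect (simplex v x); last exact: star_move_notin.
  (* x has weight 0 at a vertex of v that is not a vertex of u *)
  have [l nl] := tri_sep tK vK uK (fun e => uv (esym e)).
  apply: (star_move_out _ ip (i := l)).
  have /simplexP[w ww we] := xv; rewrite -we bary_mul ?ww.2//.
  rewrite le_eqVlt; apply/orP; left; apply: contraNT nl.
  by apply: (tri_share tK vK uK ww); rewrite we.
have [A [b [dA Ab]]] := star_move_affine i ip ip'.
by exists A, b; rewrite dA gt_eqF// if_same.
Qed.

End StarMove.

(** * The triangulation of the cube by coordinate orders *)

Section Kuhn.
Variables (R : realType) (n : nat).
Implicit Types (s t : {perm 'I_n}) (w : 'rV[R]_n.+1) (x : 'rV[R]_n).

(** The k-th vertex is the sum of the basis vectors of index s 0, ..., s (k - 1); the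
    simplex consists of the x with 1 >= x_(s 0) >= ... >= x_(s (n-1)) >= 0. *)
Definition kuhn s : 'M[R]_(n.+1, n) :=
  \matrix_(k, i) ((s^-1)%g i < k)%N%:R.

(** The coordinate s j of the point with weights w in [kuhn s] is [utail w j.+1]. *)
Definition utail w (m : nat) : R := \sum_(k < n.+1 | (m <= k)%N) w 0 k.

Lemma utail0 w : utail w 0 = \sum_k w 0 k.
Proof. by []. Qed.

Lemma utail_ge w m : (n < m)%N -> utail w m = 0.
Proof.
move=> nm; rewrite /utail big_pred0// => k.
by rewrite leqNgt (leq_trans _ nm)// ltnS -ltnS.
Qed.

Lemma utailS w (k : 'I_n.+1) : utail w k = w 0 k + utail w k.+1.
Proof.
rewrite /utail (bigD1 k)//=; congr (_ + _); apply: eq_bigl => j.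
by rewrite [RHS]ltn_neqAle eq_sym andbC.
Qed.

Lemma mul_kuhn s w i : (w *m kuhn s) 0 i = utail w ((s^-1)%g i).+1.
Proof.
rewrite mxE /utail [RHS]big_mkcond/=; apply: eq_bigr => k _.
by rewrite mxE; case: ifP; rewrite ?mulr1 ?mulr0.
Qed.

Lemma utail_ge0 w m : weight w -> 0 <= utail w m.
Proof. by move=> [w0 _]; exact: sumr_ge0. Qed.

Lemma utail_le w m m' : weight w -> (m <= m')%N -> utail w m' <= utail w m.
Proof.
move=> [w0 _] mm'; rewrite /utail [leRHS](bigID (fun k : 'I_n.+1 => (m' <= k)%N))/=.
rewrite [X in _ <= X + _](eq_bigl (fun k : 'I_n.+1 => (m' <= k)%N)).
  by rewrite lerDl sumr_ge0.
by move=> k; rewrite andbC andb_idr//; exact: leq_trans.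
Qed.

Lemma kuhn_indep s : affinely_independent (kuhn s).
Proof.
apply/affinely_independentP => w /rowP ws w1.
have t0 m : utail w m = 0.
  case: m => [//|m]; have [mn|nm] := ltnP m n; last by rewrite utail_ge.
  have := ws (s (Ordinal mn)).
  by rewrite mul_kuhn permK mxE.
by apply/rowP => k; have := utailS w k; rewrite !t0 addr0 mxE => /esym.
Qed.

Lemma kuhn_cube s x : simplex (kuhn s) x -> cube x.
Proof.
move=> /simplexP[w ww <-] i; rewrite mul_kuhn utail_ge0//=.
by rewrite -ww.2 -utail0 utail_le.
Qed.

Lemma sorting_perm x : exists s, forall i j : 'I_n, (i <= j)%N -> x 0 (s j) <= x 0 (s i).
Proof.
pose r := [rel i j : 'I_n | x 0 j <= x 0 i].
pose l := sort r (enum 'I_n).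
have sl : size l == n by rewrite size_sort size_enum_ord.
have ul : uniq (Tuple sl) by rewrite sort_uniq enum_uniq.
have /tuple_uniqP inj := ul.
exists (perm inj) => i j ij; rewrite !permE !(tnth_nth i)/=.
have tr : transitive r by move=> a b c /= ba ac; exact: le_trans ac ba.
have rr : reflexive r by move=> a /=.
apply: (sorted_leq_nth tr rr i _ i j) => //.
- by apply: sort_sorted => a b; exact: le_total.
- by rewrite inE (eqP sl).
- by rewrite inE (eqP sl).
Qed.

Lemma kuhn_cover x : cube x -> exists s, simplex (kuhn s) x.
Proof.
move=> xI; have [s xs] := sorting_perm x; exists s; apply/simplexP.
(* the sorted coordinates of x, preceded by 1 and followed by 0 *)
pose b (m : nat) : R := if m is j.+1 then
  (if insub j is Some i then x 0 (s i) else 0) else 1.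
have bge0 m : 0 <= b m.
  by case: m => //= j; case: insub => // i; have /andP[] := xI (s i).
have ble m : b m.+1 <= b m.
  case: m => [|j] /=.
    by case: insub => // i; have /andP[] := xI (s i).
  case: insubP => [i ij ji|_]; last exact: (bge0 j.+1).
  by rewrite insubT ?(ltn_trans (ltnSn j))// => jn; apply: xs; rewrite /= ji.
have bn : b n.+1 = 0 by rewrite /b insubF// ltnn.
pose w : 'rV[R]_n.+1 := \row_k (b k - b k.+1).
have wb m : (m <= n.+1)%N -> utail w m = b m.
  move=> /subnKC; move: (n.+1 - m)%N => d; elim: d m => [m|d IH m] mdn.
    by rewrite addn0 in mdn; rewrite mdn utail_ge// bn.
  have mn : (m < n.+1)%N by rewrite -[X in (_ < X)%N]mdn -addSnnS ltn_addr.
  by rewrite (utailS w (Ordinal mn)) mxE/= IH ?subrK// -mdn addSnnS.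
exists w; last first.
  apply/rowP => i; rewrite mul_kuhn wb ?ltnS 1?ltnW//=.
  by rewrite insubT//= => H; rewrite (_ : Sub _ _ = (s^-1)%g i) ?permKV//; exact/val_inj.
split; last by rewrite -utail0 wb.
by move=> k; rewrite mxE subr_ge0.
Qed.

(** The support of the m-th vertex of [kuhn s]. *)
Definition first s m : {set 'I_n} := [set i | ((s^-1)%g i < m)%N]%SET.

Lemma card_first s m : (m <= n)%N -> #|first s m| = m.
Proof.
move=> mn; have -> : first s m = s @: [set j : 'I_n | (j < m)%N]%SET.
  apply/setP => i; rewrite inE; apply/idP/imsetP => [im|[j]].
    by exists ((s^-1)%g i); rewrite ?inE ?permKV.
  by rewrite inE => jm ->; rewrite permK.
rewrite card_imset; last exact: perm_inj.
rewrite -sum1_card -[RHS]card_ord -[RHS]sum1_card (big_ord_widen n (fun=> 1%N) mn).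
by apply: eq_bigl => j; rewrite inE.
Qed.

Lemma kuhn_rowE s t (k l : 'I_n.+1) :
  (row k (kuhn s) == row l (kuhn t)) = (first s k == first t l).
Proof.
apply/eqP/eqP => [/rowP e|/setP e].
  apply/setP => i; have /eqP := e i; rewrite !inE !mxE eqr_nat.
  by case: (_ < _)%N; case: (_ < _)%N.
by apply/rowP => i; have := e i; rewrite !inE !mxE => ->.
Qed.

(** A vertex k of positive weight is a gap between consecutive coordinates of x in
    decreasing order, so the first k indices for s are those of the coordinates above a
    threshold.  This set depends on x only, and is an initial segment for the order t
    too. *)
Lemma kuhn_share_sub s t w w' (k : 'I_n.+1) : weight w -> weight w' ->
  w *m kuhn s = w' *m kuhn t -> w 0 k != 0 -> first s k \subset first t k.
Proof.
move=> ww ww' /rowP e wk.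
have lt_tail : utail w k.+1 < utail w k.
  by rewrite [ltRHS]utailS ltrDr lt_neqAle eq_sym wk ww.1.
have inS i : (i \in first s k) = (utail w k <= (w *m kuhn s) 0 i).
  rewrite inE mul_kuhn; case: ltnP => ik; first by rewrite utail_le.
  by apply/esym/negbTE; rewrite -ltNge (le_lt_trans _ lt_tail)// utail_le// ltnS.
apply/fintype.subsetP => i si; rewrite inE ltnNge; apply/negP => ki.
have sub : first t ((t^-1)%g i).+1 \subset first s k.
  apply/fintype.subsetP => j; rewrite inS inE ltnS => ji.
  by move: si; rewrite inS => /le_trans; apply; rewrite !e !mul_kuhn utail_le.
have := subset_leq_card sub; rewrite !card_first// ?leq_ord//.
by rewrite ltnNge ki.
Qed.

Lemma kuhn_triangulation : triangulation [seq kuhn s | s <- enum {perm 'I_n}].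
Proof.
split.
- by move=> _ /mapP[s _ ->]; exact: kuhn_indep.
- by move=> _ x /mapP[s _ ->]; exact: kuhn_cube.
- move=> x /kuhn_cover[s xs]; exists (kuhn s) => //.
  by apply/mapP; exists s; rewrite ?mem_enum.
- move=> _ _ w /mapP[s _ ->] /mapP[t _ ->] ww /simplexP[w' ww' e] k wk.
  apply/existsP; exists k; rewrite kuhn_rowE eqEcard (kuhn_share_sub ww ww')//.
  by rewrite !card_first ?leqnn ?leq_ord.
- move=> _ _ /mapP[s _ ->] /mapP[t _ ->] st; apply: contrapT => H; apply: st.
  apply/row_matrixP => k; apply/eqP.
  have /existsP[l] : share (kuhn s) (kuhn t) k.
    by rewrite -[share _ _ _]negbK; apply/negP => nk; apply: H; exists k.
  rewrite !kuhn_rowE => /eqP e.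
  have := congr1 (fun A : {set 'I_n} => #|A|) e; rewrite !card_first ?leq_ord// => kl.
  by rewrite e kl.
Qed.

(** Start from a simplex that contains x, and shrink it towards an interior point close
    to x. *)
Lemma small_simplex (O : set 'rV[R]_n) x : open O -> O x -> cube x ->
  exists K v, [/\ triangulation K, v \in K & simplex v `<=` O].
Proof.
move=> oO Ox xI; have [v vK xv] := tri_cover kuhn_triangulation xI.
have /nbhs_ballP[r /= r0 rO] : nbhs x O by exact: open_nbhs_nbhs.
have [w [w0 w1] we] := (simplexP _ _).1 xv.
(* x is first moved by at most e into the interior, then the simplex is shrunk by e *)
pose e : R := Num.min (2^-1) (r / 4).
have e0 : 0 < e by rewrite lt_min invr_gt0 ltr0n divr_gt0.
have e1 : e <= 2^-1 by rewrite ge_min lexx.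
have er : e <= r / 4 by rewrite ge_min lexx orbT.
clearbody e.
pose c : 'rV[R]_n.+1 := uniform_weight R n.
have ic : interior_weight c := uniform_weight_interior R n.
pose pi := (1 - e) *: w + e *: c.
have ipi : interior_weight pi.
  have piE k : pi 0 k = (1 - e) * w 0 k + e * c 0 k.
    by rewrite /pi mxE [X in X + _]mxE [X in _ + X]mxE.
  split=> [k|].
    by rewrite piE ltr_wpDl ?mulr_ge0 ?w0 ?mulr_gt0 ?ic.1//; lra.
  by under eq_bigr do rewrite piE; rewrite big_split/= -!mulr_sumr w1 ic.2; ring.
have [K' tK' vK'] := shrink_triangulation kuhn_triangulation vK ipi
  ltac:(apply/andP; split; [exact: e0|lra]).
exists K', (pull v (pi *m v) (fun=> e)); split=> //.
move=> z /simplexP[w' ww' <-]; apply: rO; split=> // i j; rewrite ord1 {i}.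
have -> : w' *m pull v (pi *m v) (fun=> e) =
    (1 - e) *: ((1 - e) *: x + e *: (c *m v)) + e *: (w' *m v).
  rewrite mul_pull -mulr_suml ww'.2 mul1r; congr (_ + _).
    by rewrite /pi mulmxDl -!scalemxAl we.
  by rewrite scalemxAl; congr (_ *m _); apply/rowP => k; rewrite !mxE mulrC.
have cI : cube (c *m v).
  apply: (tri_cube kuhn_triangulation vK); apply/simplexP.
  by exists c => //; exact: interior_weightW.
have yI : cube (w' *m v).
  by apply: (tri_cube kuhn_triangulation vK); apply/simplexP; exists w'.
clearbody c; move: (xI j) (cI j) (yI j); rewrite /ball/= !mxE.
set a := x 0 j; set b := (\sum_k c 0 k * v k j); set d := (\sum_k w' 0 k * v k j).
move=> /andP[a0 a1] /andP[b0 b1] /andP[d0 d1].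
rewrite ltr_norml; apply/andP; split; nra.
Qed.

End Kuhn.

(** * Maps made of finitely many affine pieces *)

Lemma near_neq (T Y : topologicalType) (f g : T -> Y) (x : T) :
  hausdorff_space Y -> {for x, continuous f} -> {for x, continuous g} ->
  f x <> g x -> \forall y \near x, f y <> g y.
Proof.
rewrite open_hausdorff => hY cf cg /eqP /hY[[A B] /= [fA gB] [oA oB AB]].
rewrite !inE in fA gB.
have nf : \forall y \near x, A (f y) by apply: cf; exact: open_nbhs_nbhs.
have ng : \forall y \near x, B (g y) by apply: cg; exact: open_nbhs_nbhs.
near=> y => fg; suff : (A `&` B) (f y) by rewrite (eqP AB).
by split; [near: y|rewrite fg; near: y].
Unshelve. all: by end_near. Qed.

Section AffinePieces.
Variables (R : realType) (n : nat).
Local Notation aff := ('M[R]_n * 'rV[R]_n)%type.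
Implicit Types (p : aff) (L : seq aff) (x : 'rV[R]_n).

Definition affine p x : 'rV[R]_n := x *m p.1 + p.2.

Lemma affine_id x : affine (1%:M, 0) x = x.
Proof. by rewrite /affine mulmx1 addr0. Qed.

(** Being given pointwise by finitely many invertible affine maps is a weak form of
    being PL, but one that passes to compositions and inverses at once, without common
    subdivisions. *)
Lemma PL_cube_pieces o f : @PL_cube R n o f -> exists2 L : seq aff,
  (forall p : aff, p \in L -> p.1 \in unitmx) &
  forall x, cube x -> exists2 p : aff, p \in L & f x = affine p x.
Proof.
elim=> {f} [f [_ [K [_ Kc _] Kf]]||f g Pf [L Lu Lf] Pg [L' L'u L'g]|f g Pf [L Lu Lf] gI fK].
- have /choice[F FP] : forall v, exists p, v \in K ->
      p.1 \in unitmx /\ forall x, simplex v x -> f x = affine p x.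
    move=> v; have [vK|_] := boolP (v \in K); last by exists (1%:M, 0).
    have [A [b [dA fA]]] := Kf v vK; exists (A, b) => _; split=> //=.
    by rewrite unitmxE unitfE; move: dA; case: (o) => // /lt0r_neq0.
  exists [seq F v | v <- K]; first by move=> _ /mapP[v vK ->]; case: (FP v vK).
  move=> x; rewrite -Kc => -[v /= vK vx]; exists (F v); last by apply: (FP v vK).2.
  by apply/mapP; exists v.
- exists [:: (1%:M, 0)]; first by move=> p; rewrite inE => /eqP ->; exact: unitmx1.
  by move=> x _; exists (1%:M, 0); rewrite ?mem_head// affine_id.
- exists [seq (q.1 *m p.1, q.2 *m p.1 + p.2) | p <- L, q <- L'].
    move=> _ /allpairsP[[p q] [/= pL qL' ->]] /=.
    by rewrite unitmx_mul L'u// Lu.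
  move=> x xI; have [g' [gI _ _ _]] := PL_cube_bij Pg.
  have [q qL' gx] := L'g x xI; have [p pL fgx] := Lf (g x) (gI _ xI).
  exists (q.1 *m p.1, q.2 *m p.1 + p.2).
    by apply/allpairsP; exists (p, q).
  by rewrite /= fgx gx /affine/= mulmxDl mulmxA addrA.
- exists [seq (invmx p.1, - (p.2 *m invmx p.1)) | p <- L].
    by move=> _ /mapP[p pL ->] /=; rewrite unitmx_inv Lu.
  move=> x xI; have [p pL fgx] := Lf (g x) (gI _ xI).
  exists (invmx p.1, - (p.2 *m invmx p.1)); first by apply/mapP; exists p.
  have xE : x = g x *m p.1 + p.2 by rewrite -[LHS](fK x) ?inE.
  by rewrite /affine/= [in RHS]xE mulmxDl addrK mulmxK// Lu.
Qed.

(** An affine map that fixes every point of a ball is the identity. *)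
Lemma affine_fixed_thin p (V : set 'rV[R]_n) : p != (1%:M, 0) -> open V ->
  V !=set0 -> exists2 x, V x & affine p x <> x.
Proof.
move=> p1 oV [x Vx]; apply: contrapT => H; move/eqP: p1; apply.
have fixed y : V y -> affine p y = y.
  by move=> Vy; apply: contrapT => ny; apply: H; exists y.
have /nbhs_ballP[r /= r0 rV] : nbhs x V by exact: open_nbhs_nbhs.
have lin (u : 'rV[R]_n) : u *m p.1 = u.
  pose t := r / (`|u| + 1).
  have t0 : 0 < t by rewrite divr_gt0// ltr_wpDl.
  have : affine p (x + t *: u) = x + t *: u.
    apply/fixed/rV; rewrite -ball_normE /ball_/= opprD addrA subrr add0r normrN.
    rewrite normrZ gtr0_norm// /t -mulrA gtr_pMr// mulrC ltr_pdivrMr ?ltr_wpDl//.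
    by rewrite mul1r ltrDl.
  rewrite /affine mulmxDl addrAC -scalemxAl [X in X + _](fixed x Vx).
  by move=> /addrI/scalerI; apply; rewrite gt_eqF.
have e1 : p.1 = 1%:M.
  by apply/row_matrixP => i; rewrite !rowE mulmx1 lin.
have := fixed x Vx; rewrite /affine lin => /eqP; rewrite -subr_eq0 addrC addrA addNr add0r.
by move=> /eqP e2; rewrite [p]surjective_pairing e1 e2.
Qed.

Lemma affine_continuous p : continuous (affine p).
Proof.
have -> : affine p = fun x => \sum_j x 0 j *: row j p.1 + p.2.
  by apply/funext => x; rewrite /affine mulmx_sum_row.
move=> x; apply: (@continuousD _ 'rV[R]_n 'rV[R]_n
  (fun x => \sum_j x 0 j *: row j p.1) (fun=> p.2)); last exact: cst_continuous.
apply: (@continuous_big 'rV[R]_n _ +%R 0 xpredT add_continuous 'rV[R]_n _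
  (fun j x => x 0 j *: row j p.1)) => j _ y.
apply: (@continuousZr_tmp _ _ _ (fun x : 'rV[R]_n => x 0 j) (row j p.1)).
exact: coord_continuous.
Qed.

Lemma avoid_fixed L (V : set 'rV[R]_n) : (forall p, p \in L -> p != (1%:M, 0)) ->
  open V -> V !=set0 -> exists V', [/\ open V', V' !=set0, V' `<=` V &
    forall p x, p \in L -> V' x -> affine p x <> x].
Proof.
elim: L V => [|p L IH] V L1 oV V0; first by exists V; split.
have [|V1 [oV1 V10 V1V V1L]] := IH V _ oV V0.
  by move=> q qL; apply: L1; rewrite inE qL orbT.
have [x V1x px] := affine_fixed_thin (L1 p (mem_head _ _)) oV1 V10.
have nx := near_neq (@norm_hausdorff _ _) (@affine_continuous p x) (@cvg_id _ (nbhs x)) px.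
exists (V1 `&` (fun y => affine p y <> y)°); split.
- by apply: openI => //; exact: open_interior.
- by exists x.
- by move=> y [/V1V].
- move=> q y; rewrite inE => /orP[/eqP ->|qL] [V1y py]; first exact: nbhs_singleton py.
  exact: V1L.
Qed.

(** The fixed points of phi in D form an open set as well as a closed one: near a fixed
    point, phi cannot agree with an affine map that moves this point, so the identity is
    the only possibility left. *)
Lemma finite_affine_rigid L (D : set 'rV[R]_n) (phi : 'rV[R]_n -> 'rV[R]_n) x0 :
  open D -> connected D -> (forall x, D x -> {for x, continuous phi}) ->
  (forall x, D x -> exists2 p, p \in L & phi x = affine p x) ->
  (forall p x, p \in L -> p != (1%:M, 0) -> D x -> affine p x <> x) ->
  D x0 -> phi x0 = x0 -> forall x, D x -> phi x = x.
Proof.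
move=> oD cD cphi phiL Lfix Dx0 phix0.
pose B := D `&` [set x | phi x = x].
suff BD : B = D by move=> x; rewrite -BD => -[].
apply: cD; first by exists x0.
  exists B; last by apply/seteqP; split=> x; rewrite /B/=; tauto.
  rewrite openE => x [Dx fx]; rewrite /interior.
  have nL : \forall y \near x, forall p, p \in L -> p != (1%:M, 0) ->
      phi y <> affine p y.
    elim: L {phiL} Lfix => [_|p L IH Lfix]; first by near=> y.
    have IH' := IH (fun q y qL => Lfix q y (mem_behead (s := p :: L) qL)).
    have [p1|p1] := eqVneq p (1%:M, 0).
      apply: filterS IH' => y H q; rewrite inE => /orP[/eqP ->|]; last exact: H.
      by rewrite p1 eqxx.
    have np : \forall y \near x, phi y <> affine p y.
      apply: near_neq (@norm_hausdorff _ _) (cphi x Dx) (@affine_continuous p x) _.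
      by rewrite fx => /esym; exact: (Lfix p x (mem_head _ _) p1 Dx).
    near=> y => q; rewrite inE => /orP[/eqP ->|qL q1]; first by move=> _; near: y.
    by move: (q) qL q1; near: y.
  have nD : \forall y \near x, D y by exact: open_nbhs_nbhs.
  near=> y; have Dy : D y by near: y.
  split=> //=; have [p pL py] := phiL y Dy.
  have [p1|p1] := eqVneq p (1%:M, 0); first by rewrite py p1 affine_id.
  exfalso; move: p pL p1 py; near: y.
  by apply: filterS nL => y H p pL p1; exact: H.
exists (closure B); first exact: closed_closure.
apply/seteqP; split=> x; first by move=> Bx; split; [case: Bx|exact: subset_closure].
move=> [Dx clx]; split=> //=; apply: contrapT => nx.
have := near_neq (@norm_hausdorff _ _) (cphi x Dx) (@cvg_id _ (nbhs x)) nx.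
by move=> /clx[y [[_ yy]]]; exact.
Unshelve. all: by end_near. Qed.

End AffinePieces.

(** * A sequence of balls in general position *)

Section Scattered.
Variables (R : realType) (n : nat).
Implicit Types (x y c : 'rV[R]_n).

Lemma rV_ballP x (e : R) y : 0 < e ->
  ball x e y <-> forall j, `|x 0 j - y 0 j| < e.
Proof.
by move=> e0; split=> [[_ H] j|H]; [exact: H|split=> // i j; rewrite ord1; exact: H].
Qed.

Lemma ball_connected x (e : R) : 0 < e -> connected (ball x e).
Proof.
move=> e0; have -> : ball x e =
    \bigcup_(y in ball x e) ((fun t : R => x + t *: (y - x)) @` `[0, 1]).
  apply/seteqP; split=> y.
    move=> xy; exists y => //; exists 1; first by rewrite /= in_itv/= ler01 lexx.
    by rewrite scale1r addrC subrK.
  move=> [z]; rewrite -ball_normE /= => xz [t] /=; rewrite in_itv/= => /andP[t0 t1] <-.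
  rewrite opprD addrA subrr add0r normrN normrZ ger0_norm// distrC.
  by rewrite (le_lt_trans _ xz)// ler_piMl.
apply: bigcup_connected.
  exists x => y _; exists 0; first by rewrite /= in_itv/= lexx ler01.
  by rewrite scale0r addr0.
move=> y _; apply: connected_continuous_connected; first exact: segment_connected.
apply: continuous_subspaceT => t.
apply: (@continuousD _ 'rV[R]_n _ (fun=> x) (fun t : R => t *: (y - x))).
  exact: cst_continuous.
by apply: (@continuousZr_tmp _ _ _ (fun t : R => t) (y - x)); exact: cvg_id.
Qed.

(** A countable base made of balls with rational centres. *)
Definition rat_ball (k : nat) : 'rV[R]_n * R :=
  if @unpickle ('rV[rat]_n * nat)%type k is Some (q, m)
  then (map_mx ratr q, m.+1%:R^-1) else (0, 1).

Lemma rat_ball_gt0 k : 0 < (rat_ball k).2.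
Proof.
by rewrite /rat_ball; case: unpickle => [[q m]|] /=; rewrite ?invr_gt0 ?ltr01 ?ltr0n.
Qed.

Lemma rat_ball_base (V : set 'rV[R]_n) : open V -> V !=set0 ->
  exists k, ball (rat_ball k).1 (rat_ball k).2 `<=` V.
Proof.
move=> oV [x Vx]; have /nbhs_ballP[e /= e0 eV] : nbhs x V by exact: open_nbhs_nbhs.
have /choice[q qP] : forall j, exists q : rat, `|x 0 j - ratr q| < e / 2.
  move=> j; have [|q] := @rat_in_itvoo R (x 0 j) (x 0 j + e / 2).
    by rewrite ltrDl divr_gt0.
  rewrite in_itv/= => /andP[q1 q2]; exists q.
  by rewrite distrC gtr0_norm ?subr_gt0// ltrBlDl.
pose m := Num.truncn (2 / e).
have me : m.+1%:R^-1 < e / 2.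
  rewrite -(invrK (e / 2)) ltf_pV2 ?posrE ?ltr0n ?invr_gt0 ?divr_gt0//.
  by rewrite invf_div; apply: truncnS_gt.
exists (pickle ((\row_j q j), m)); rewrite /rat_ball pickleK => y.
move=> /rV_ballP; rewrite invr_gt0 ltr0n => /(_ isT) /= H.
apply/eV/rV_ballP => // j; have := H j; rewrite !mxE => Hj.
rewrite (le_lt_trans (ler_distD (ratr (q j)) _ _))// (splitr e).
by rewrite ltrD// (lt_trans Hj).
Qed.

Hypothesis n0 : (0 < n)%N.
Variables (p0 : 'rV[R]_n) (r : R).
Hypothesis r0 : 0 < r.

(* The directions from p0: all the coordinates of the elements of V0 are between 1/2
   and 1, which makes the sets p0 + r 2^-i V0 disjoint for distinct i. *)
Let c0 : 'rV[R]_n := const_mx (3 / 4).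
Let V0 := ball c0 (8^-1 : R).

(* The multiplicity of 2 in i.+1 takes every value infinitely often, so that every ball
   of the base contained in V0 is used at arbitrarily small scales. *)
Let dir i : 'rV[R]_n * R :=
  let b := rat_ball (logn 2 i.+1) in
  if `[< ball b.1 b.2 `<=` V0 >] then b else (c0, 8^-1).

Let eps i : R := r / 2 ^+ i.

(** The i-th ball is the image of the ball [dir i] of directions at scale r 2^-i from p0. *)
Definition scattered i : set 'rV[R]_n :=
  ball (p0 + eps i *: (dir i).1) (eps i * (dir i).2).

Let dir_gt0 i : 0 < (dir i).2.
Proof. by rewrite /dir; case: asboolP => _ /=; [exact: rat_ball_gt0|rewrite invr_gt0 ltr0n]. Qed.

Let eps_gt0 i : 0 < eps i.
Proof. by rewrite divr_gt0// exprn_gt0. Qed.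

Let dir_sub i : ball (dir i).1 (dir i).2 `<=` V0.
Proof. by rewrite /dir; case: asboolP => [H|_] y /=; [exact: H|exact]. Qed.

Lemma scattered_scale i x : scattered i x ->
  exists2 w, ball (dir i).1 (dir i).2 w & x = p0 + eps i *: w.
Proof.
move=> xi; have e_neq0 : eps i != 0 by rewrite gt_eqF.
exists ((eps i)^-1 *: (x - p0)); last by rewrite scalerA divff// scale1r addrC subrK.
move: xi; rewrite /scattered -!ball_normE /= => xi.
rewrite -(ltr_pM2l (eps_gt0 i)) -[X in X * _]gtr0_norm// -normrZ.
by rewrite scalerBr scalerA divff// scale1r opprB addrA [_ + p0]addrC.
Qed.

Lemma scattered_coord i x j : scattered i x -> eps i / 2 < x 0 j - p0 0 j < eps i.
Proof.
move=> /scattered_scale[w /dir_sub/rV_ballP wV ->].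
have : `|c0 0 j - w 0 j| < 8^-1 by apply: wV; rewrite invr_gt0 ltr0n.
rewrite !mxE ltr_norml => /andP[w1 w2]; have e0 := eps_gt0 i.
by apply/andP; split; nra.
Qed.

Lemma scattered_open i : open (scattered i).
Proof. exact: ball_open. Qed.

Lemma scattered_nonempty i : scattered i !=set0.
Proof. by exists (p0 + eps i *: (dir i).1); apply: ballxx; rewrite mulr_gt0. Qed.

Lemma scattered_connected i : connected (scattered i).
Proof. by apply: ball_connected; rewrite mulr_gt0. Qed.

Lemma scattered_ball i : scattered i `<=` ball p0 (eps i).
Proof.
move=> x xi; apply/rV_ballP => // j; have /andP[x1 x2] := scattered_coord j xi.
have e0 := eps_gt0 i; rewrite distrC gtr0_norm//; lra.
Qed.

Lemma scattered_sub i : scattered i `<=` ball p0 r.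
Proof.
apply: subset_trans (@scattered_ball i) _; apply: le_ball.
by rewrite ler_pdivrMr ?exprn_gt0// ler_peMr ?exprn_ege1 ?ler1n ?ltW.
Qed.

Let eps_le i j : (i <= j)%N -> eps j <= eps i.
Proof.
by move=> ij; rewrite /eps ler_pM2l// lef_pV2 ?posrE ?exprn_gt0// ler_weXn2l// ler1n.
Qed.

Lemma scattered_disjoint i j x : scattered i x -> scattered j x -> i = j.
Proof.
wlog ij : i j / (i < j)%N.
  move=> H xi xj; case: (ltngtP i j) => // ij; first exact: H.
  by apply/esym; exact: H.
move=> xi xj; pose k := Ordinal n0.
have /andP[x1 _] := scattered_coord k xi; have /andP[_ x2] := scattered_coord k xj.
have le_ji : eps j <= eps i / 2.
  by apply: le_trans (eps_le ij) _; rewrite /eps exprSr invfM mulrA.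
exfalso; lra.
Qed.

Lemma scattered_small (e : R) : 0 < e -> exists N, forall i, (N <= i)%N -> eps i <= e.
Proof.
move=> e0; pose N := Num.truncn (r / e); exists N.+1 => i Ni.
apply: le_trans (eps_le Ni) _; rewrite /eps ler_pdivrMr ?exprn_gt0//.
rewrite mulrC -ler_pdivrMr// ltW// (lt_le_trans (truncnS_gt _))//.
by rewrite -natrX ler_nat ltnW// ltn_expl.
Qed.

(** The fixed points of a map of L that fixes p0 form a cone with apex p0, which some ball
    of directions avoids at every scale; the other maps of L have no fixed point near
    p0. *)
Lemma scattered_avoid (L : seq ('M[R]_n * 'rV[R]_n)) N :
  (forall p, p \in L -> p != (1%:M, 0)) ->
  exists2 i, (N <= i)%N & forall p x, p \in L -> scattered i x -> affine p x <> x.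
Proof.
move=> L1.
(* the maps of L that fix p0, read on the directions *)
pose L0 := [seq (p.1, 0 : 'rV[R]_n) | p <- L & affine p p0 == p0].
have L01 p : p \in L0 -> p != (1%:M, 0).
  move=> /mapP[q]; rewrite mem_filter => /andP[/eqP q0 qL] ->.
  apply: contra_neq (L1 q qL) => -[q1].
  have := q0; rewrite /affine q1 mulmx1 -{2}[p0]addr0 => /addrI q2.
  by rewrite [q]surjective_pairing q1 q2.
have V00 : V0 !=set0 by exists c0; apply: ballxx; rewrite invr_gt0 ltr0n.
have [V [oV Vn VV0 VL]] := avoid_fixed L01 (ball_open _ _ : open V0) V00.
have [k kV] := rat_ball_base oV Vn.
have /nbhs_ballP[e /= e0 eL] : \forall x \near p0, forall p, p \in L ->
    affine p p0 <> p0 -> affine p x <> x.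
  elim: L {L1 L0 L01 VL} => [|p L IH]; first by near=> x.
  have [p1|p1] := pselect (affine p p0 = p0).
    apply: filterS IH => x H q; rewrite inE => /orP[/eqP ->//|]; exact: H.
  have np := near_neq (@norm_hausdorff _ _) (@affine_continuous _ _ p p0) (@cvg_id _ (nbhs p0)) p1.
  near=> x => q; rewrite inE => /orP[/eqP -> _|qL q1]; first by near: x.
  by move: (q) qL q1; near: x.
have [M Me] := scattered_small e0.
(* an index at which the directions are the k-th ball, large enough for the scale *)
pose i := (2 ^ k * (maxn N M).*2.+1).-1.
have iS : i.+1 = (2 ^ k * (maxn N M).*2.+1)%N by rewrite prednK// muln_gt0 expn_gt0.
have NMi : (maxn N M <= i)%N.
  rewrite -ltnS iS; apply: (@leq_trans (maxn N M).*2.+1).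
    by rewrite ltnS -addnn leq_addr.
  by rewrite leq_pmull// expn_gt0.
have dirE : dir i = rat_ball k.
  have -> : dir i = let b := rat_ball (logn 2 i.+1) in
    if `[< ball b.1 b.2 `<=` V0 >] then b else (c0, 8^-1) by [].
  rewrite iS lognM ?expn_gt0// pfactorK// logn_coprime ?addn0; last first.
    by rewrite coprime2n /= odd_double.
  by rewrite /= asboolT//; exact: subset_trans kV VV0.
exists i; first by apply: leq_trans NMi; exact: leq_maxl.
move=> p x pL xi; have [pp0|pp0] := pselect (affine p p0 = p0); last first.
  apply: eL => //; apply: le_ball (scattered_ball xi); apply: Me.
  by apply: leq_trans NMi; exact: leq_maxr.
have [w wk ->] := scattered_scale xi; rewrite dirE in wk.
have pL0 : (p.1, 0) \in L0 by apply/mapP; exists p => //; rewrite mem_filter pp0 eqxx.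
have := VL _ w pL0 (kV _ wk); rewrite /affine/= addr0 => nw.
rewrite mulmxDl addrAC [X in X + _]pp0 => /addrI; rewrite -scalemxAl => /scalerI e'.
by apply: nw; apply: e'; rewrite gt_eqF.
Unshelve. all: by end_near. Qed.

End Scattered.

(** * Polish groups *)

(** By Baire's theorem: a countable set has dense complement. *)
Lemma itv01_not_countable (R : realType) (k : R -> nat) :
  ~ {in [set s : R | 0 <= s < 1] &, injective k}.
Proof.
move=> kinj; pose a i := get [set s : R | 0 <= s < 1 /\ k s = i].
have od i : open (~` [set a i]) /\ dense (~` [set a i]).
  split.
    rewrite openC; apply: accessible_closed_set1.
    exact/hausdorff_accessible/norm_hausdorff.
  move=> O [x Ox] oO; have [xa|xa] := pselect (x = a i); last by exists x.
  have /nbhs_ballP[e /= e0 eO] : nbhs x O by exact: open_nbhs_nbhs.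
  exists (x + e / 2); split.
    apply: eO; rewrite /ball/= opprD addrA subrr add0r normrN gtr0_norm ?divr_gt0//.
    by rewrite ltr_pdivrMr// ltr_pMr// ltr1n.
  by move=> /eqP; rewrite -xa -subr_eq0 addrC addKr gt_eqF// divr_gt0.
have /(_ (ball (2^-1 : R) 2^-1)) [||s [sI sa]] := @Baire R R (fun i => ~` [set a i]) od.
- by exists 2^-1; apply: ballxx; rewrite invr_gt0.
- exact: ball_open.
have s01 : 0 <= s < 1.
  move: sI; rewrite /ball/= distrC ltr_norml => /andP[s1 s2].
  by apply/andP; split; lra.
have [a01 ka] : [set s' : R | 0 <= s' < 1 /\ k s' = k s] (a (k s)) by apply: getPex; exists s.
by apply: (sa (k s) I) => /=; apply: kinj => //; rewrite inE.
Qed.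

Section PolishGroup.
Variables (R : realType) (G : groupType) (tau : Topological G).
Hypothesis pol : polish_group_topology R tau.
Local Notation T := (Topological.Pack tau : topologicalType).

Let sepT : separable T. Proof. by case: pol. Qed.
Let metT : completely_metrizable R T. Proof. by case: pol. Qed.

Let tmul (a b : T) : T := ((a : G) * (b : G))%g.

Lemma polish_mul_cvg (I : Type) (F : set_system I) (f g : I -> T) (a b : T) :
  Filter F -> f @ F --> a -> g @ F --> b ->
  (fun i => tmul (f i) (g i)) @ F --> tmul a b.
Proof.
move=> FF fa gb; case: pol => _ _ mc _.
exact: (@cvg_comp _ _ _ (fun i => (f i, g i)) _ F _ _ (cvg_pair fa gb) (mc (a, b))).
Qed.

Lemma polish_hausdorff : hausdorff_space T.
Proof.
have [m [nE _]] := metT; move=> x y cl; apply: (@metric_hausdorff R (Metric.Pack m)).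
move=> A B; rewrite -!nE; exact: cl.
Qed.

(** By separability, two of the uncountably many open sets [g s * V] contain a common
    point of a countable dense set. *)
Lemma polish_close (g : R -> G) (W : set T) :
  {in [set s : R | 0 <= s < 1] &, injective g} -> nbhs (1%g : T) W ->
  exists s t, [/\ 0 <= s < 1, 0 <= t < 1, g s <> g t & W ((g s)^-1 * g t)%g].
Proof.
move=> ginj W1; have [D cD dD] := sepT.
have [V [oV V1 VW]] : exists V : set T, [/\ open V, V (1%g : T) &
    forall a b : T, V a -> V b -> W ((a : G) * (b : G)^-1 : G)%g].
  case: pol => _ _ mc ic.
  have c2 : (fun p : T * T => tmul p.1 ((p.2 : G)^-1)%g) @ nbhs (1%g : T, 1%g : T)
      --> tmul 1%g (1%g : G)^-1%g.
    apply: polish_mul_cvg; first exact: cvg_fst.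
    exact: (@cvg_comp _ _ _ snd (fun x : T => ((x : G)^-1)%g : T) _
      (nbhs (1%g : T)) _ cvg_snd (ic (1%g : T))).
  rewrite /tmul invg1 mulg1 in c2.
  have [[A B] /= [nA nB] AB] := c2 W W1.
  exists (A° `&` B°); split.
  - by apply: openI; exact: open_interior.
  - by split.
  - move=> a b [Aa _] [_ Bb].
    by have /AB : (A `*` B) (a, b) by split; exact: nbhs_singleton.
have /choice[d dP] : forall s, exists z : T, D z /\ V ((g s)^-1 * (z : G))%g.
  move=> s; have [z [Vz Dz]] : (((fun z : T => ((g s)^-1 * (z : G))%g : T) @^-1` V) `&` D) !=set0.
    apply: dD.
      by exists (g s : T); rewrite /preimage/= mulVg.
    apply: open_comp => // z _.
    exact: (@polish_mul_cvg T (nbhs z) (fun=> (g s)^-1%g) id _ _ _ (cvg_cst _) cvg_id).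
  by exists z.
have [h hinj] : exists h : T -> nat, {in D &, injective h}.
  exact/countable_injP.
apply: contrapT => H; apply: (@itv01_not_countable R (h \o d)) => s t.
rewrite !inE => s01 t01 hst; apply: ginj; rewrite ?inE//.
have dst : d s = d t by apply: hinj; rewrite ?inE; [exact: (dP s).1|exact: (dP t).1|].
apply: contrapT => st; apply: H; exists s, t; split=> //.
have := VW _ _ (dP s).2 (dP t).2; rewrite dst invgM invgK.
by rewrite mulgA mulgK.
Qed.

(** As the complete metric is not supposed to be invariant, each factor is chosen after
    the previous partial product, so close to 1 that multiplying by it moves this
    product by less than 2^-i. *)
Lemma polish_product (S : nat -> set G) :
  (forall i (W : set T), nbhs (1%g : T) W -> exists2 f, S i f & W f) ->
  exists (f P : nat -> G) (F : G),
  [/\ forall i, S i (f i), P 0%N = 1%g, forall i, P i.+1 = (P i * f i)%g &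
      (P : nat -> T) @ \oo --> (F : T)].
Proof.
move=> HS; have [m [nE cauchyT]] := metT; pose T' : metricType R := Metric.Pack m.
have step i (x : G) : exists f, S i f /\ ball (x : T') ((2^-1) ^+ i : R) (x * f)%g.
  have c1 : (fun f : T => tmul x f) @ nbhs (1%g : T) --> tmul x 1%g.
    exact: (@polish_mul_cvg T (nbhs (1%g : T)) (fun=> x) id x 1%g _ (cvg_cst _) cvg_id).
  rewrite /tmul mulg1 in c1.
  have nb : nbhs (x : T) (ball (x : T') ((2^-1) ^+ i : R)).
    by rewrite nE; apply: nbhsx_ballx; rewrite exprn_gt0// invr_gt0.
  by have [f Sf bf] := HS i _ (c1 _ nb); exists f.
have /choice[sel selP] : forall p : nat * G, exists f, S p.1 f /\
  ball (p.2 : T') ((2^-1) ^+ p.1 : R) (p.2 * f)%g by move=> [i x]; exact: step.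
pose P := fix P i : G := if i is j.+1 then (P j * sel (j, P j))%g else 1%g.
pose f i := sel (i, P i).
have Pball i j : (i <= j)%N -> ball (P i : T') (2 * (2^-1) ^+ i : R) (P j).
  move=> /subnKC <-; move: (j - i)%N => k {j}.
  elim: k i => [|k IH] i.
    by rewrite addn0; apply: ballxx; rewrite mulr_gt0// exprn_gt0// invr_gt0.
  rewrite -addSnnS; apply: (@le_ball _ _ _ ((2^-1) ^+ i + 2 * (2^-1) ^+ i.+1)).
    by move: ((2^-1) ^+ i) (exprS (2^-1 : R) i) => y ->; lra.
  by apply: ball_triangle (IH i.+1); exact: (selP (i, P i)).2.
have cP : cauchy ((P : nat -> T') @ \oo).
  apply: cauchy_exP => e e0.
  have [N Ne] : exists N, 2 * (2^-1) ^+ N <= e.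
    pose N := Num.truncn (2 / e); exists N.
    rewrite exprVn ler_pdivrMr ?exprn_gt0// mulrC -ler_pdivrMr// ltW//.
    rewrite (lt_le_trans (truncnS_gt _))// -natrX ler_nat.
    exact: ltn_expl.
  exists (P N); exists N => // j /= Nj.
  by apply: le_ball Ne _ _; exact: Pball.
have [F PF] := cauchyT _ _ cP.
exists f, P, F; split=> //; first by move=> i; exact: (selP (i, P i)).1.
move=> A; rewrite nE; exact: PF.
Qed.

(** The elements whose product with a commutes with g form a closed set. *)
Lemma polish_lim_commute (P : nat -> G) (F a g : G) (N : nat) :
  (P : nat -> T) @ \oo --> (F : T) ->
  (forall j, (N <= j)%N -> (P j * a * g = g * (P j * a))%g) ->
  (F * a * g = g * (F * a))%g.
Proof.
move=> PF comm.
have c1 : (fun j => tmul (tmul (P j) a) g) @ \oo --> tmul (tmul F a) g.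
  by apply: polish_mul_cvg; [apply: polish_mul_cvg => //|]; exact: cvg_cst.
have c2 : (fun j => tmul g (tmul (P j) a)) @ \oo --> tmul g (tmul F a).
  apply: polish_mul_cvg; first exact: cvg_cst.
  by apply: polish_mul_cvg => //; exact: cvg_cst.
apply: (cvg_unique polish_hausdorff c1).
apply: cvg_trans c2; apply: near_eq_cvg.
by exists N => // j /= Nj; rewrite /tmul comm.
Qed.

End PolishGroup.

(** * Carrying maps of the cube to the manifold *)

Section Charts.
Variables (R : realType) (n : nat) (M : topologicalType).
Implicit Types (c : chart R n M).

(** A chart c with an explicit inverse gc, defined on the open subset of the cube that
    is the intersection with O. *)
Record chart_inverse c (O : set 'rV[R]_n) (gc : 'rV[R]_n -> M) : Prop := ChartInverse {
  ci_open_dom : open (chart_dom c);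
  ci_open : open O;
  ci_map : forall x, chart_dom c x -> (@cube R n `&` O) (c x);
  ci_inv : forall z, (@cube R n `&` O) z -> chart_dom c (gc z);
  ci_mapK : forall x, chart_dom c x -> gc (c x) = x;
  ci_invK : forall z, (@cube R n `&` O) z -> c (gc z) = z;
  ci_map_cont : forall x, chart_dom c x -> {for x, continuous c};
  ci_inv_cont : {within @cube R n `&` O, continuous gc} }.

Lemma chart_inverseP c : is_chart c -> exists O gc, chart_inverse c O gc.
Proof.
move=> [od [O oO [gc [cI gI [cK gK] cc gcc]]]]; exists O, gc; split=> //.
- by move=> x dx; apply: cK; rewrite inE.
- by move=> z Oz; apply: gK; rewrite inE.
- by move=> x dx; move: cc; rewrite continuous_open_subspace// => /(_ x); apply; rewrite inE.
Qed.

Variables (c : chart R n M) (O : set 'rV[R]_n) (gc : 'rV[R]_n -> M).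
Hypothesis ci : chart_inverse c O gc.

Lemma ci_inv_near z (N : set M) : (@cube R n `&` O) z -> nbhs (gc z) N ->
  \forall y \near z, (@cube R n `&` O) y -> N (gc y).
Proof.
move=> Oz nN; have /subspace_continuousP/(_ z Oz _ nN) := ci_inv_cont ci.
by [].
Qed.

Lemma ci_inv_at z : nbhs z (@cube R n `&` O) -> {for z, continuous gc}.
Proof.
move=> nO N nN; have Oz := nbhs_singleton nO.
apply: (@filterS2 _ (nbhs z) _ _ _ _ _ nO (ci_inv_near Oz nN)) => y Oy; exact.
Qed.

End Charts.

Lemma cube_compact (R : realType) n : compact (@cube R n).
Proof.
apply: (@rV_compact R n (fun=> `[0, 1]%classic)) => i; exact: segment_compact.
Qed.

Section Extension.
Variables (R : realType) (o : bool) (n : nat) (M : topologicalType).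
Variable S : PL_structure R o n M.
Hypothesis hM : hausdorff_space M.
Variables (c : chart R n M) (O : set 'rV[R]_n) (gc : 'rV[R]_n -> M).
Hypotheses (Sc : atlas S c) (ci : chart_inverse c O gc).
Variable C : set 'rV[R]_n.
Hypotheses (CO : C `<=` @cube R n `&` O) (kC : compact C).

(** The map phi read in the chart c, extended by the identity. *)
Definition chart_extend (phi : 'rV[R]_n -> 'rV[R]_n) (x : M) : M :=
  if `[< chart_dom c x >] then gc (phi (c x)) else x.

Section OneMap.
Variables (phi phi' : 'rV[R]_n -> 'rV[R]_n).
Hypothesis phiK : cancel phi phi'.
Hypotheses (phiC : forall z, ~ C z -> phi z = z) (phi'C : forall z, ~ C z -> phi' z = z).
Hypothesis cphi : continuous phi.

Lemma phi_stable z : (@cube R n `&` O) z -> (@cube R n `&` O) (phi z).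
Proof.
move=> Oz; have [Cz|/phiC -> //] := pselect (C z).
apply: CO; apply: contrapT => nC; apply: nC.
have := phi'C (z := phi z); have [//|nC /(_ nC)] := pselect (C (phi z)).
by rewrite phiK => <-.
Qed.

Lemma chart_extend_in x : chart_dom c x -> chart_extend phi x = gc (phi (c x)).
Proof. by move=> dx; rewrite /chart_extend asboolT. Qed.

Lemma chart_extend_dom x : chart_dom c x -> chart_dom c (chart_extend phi x).
Proof.
move=> dx; rewrite chart_extend_in//; apply: (ci_inv ci); apply: phi_stable.
exact: (ci_map ci).
Qed.

Lemma chart_extend_map x : chart_dom c x -> c (chart_extend phi x) = phi (c x).
Proof.
move=> dx; rewrite chart_extend_in// (ci_invK ci)//; apply: phi_stable.
exact: (ci_map ci).
Qed.

Lemma chart_extend_out x : ~ (gc @` C) x -> chart_extend phi x = x.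
Proof.
move=> nx; have [dx|dx] := pselect (chart_dom c x); last by rewrite /chart_extend asboolF.
rewrite chart_extend_in// phiC ?(ci_mapK ci)// => Cx; apply: nx.
by exists (c x) => //; exact: (ci_mapK ci).
Qed.

(** The support is compact, and M is Hausdorff: this is what makes the extension by the
    identity continuous at the points of the frontier of the chart domain. *)
Lemma support_closed : closed (gc @` C).
Proof.
apply: compact_closed => //; apply: continuous_compact => //.
exact: continuous_subspaceW (ci_inv_cont ci).
Qed.

Lemma support_near x : ~ (gc @` C) x -> \forall y \near x, ~ (gc @` C) y.
Proof.
move=> nx; have oC : open (~` (gc @` C)) by rewrite openC; exact: support_closed.
exact: (open_nbhs_nbhs (conj oC nx)).
Qed.

Lemma support_dom : gc @` C `<=` chart_dom c.
Proof. by move=> _ [z /CO Oz <-]; exact: (ci_inv ci). Qed.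

Lemma chart_extend_continuous : continuous (chart_extend phi).
Proof.
move=> x; have [dx|dx] := pselect (chart_dom c x); last first.
  have nx : ~ (gc @` C) x by move=> /support_dom.
  rewrite /continuous_at chart_extend_out//.
  apply: cvg_trans (@cvg_id _ (nbhs x)); apply: near_eq_cvg.
  by apply: filterS (support_near nx) => y ny; rewrite /= chart_extend_out.
move=> N; rewrite chart_extend_in// => nN.
have n1 : \forall y \near phi (c x), (@cube R n `&` O) y -> N (gc y).
  by apply: (ci_inv_near ci) => //; apply: phi_stable; exact: (ci_map ci).
have n2 : \forall y \near x, (@cube R n `&` O) (phi (c y)) -> N (gc (phi (c y))).
  have n3 := cphi n1; have n4 := ci_map_cont ci dx n3; exact n4.
have nd : \forall y \near x, chart_dom c y.
  by apply: open_nbhs_nbhs; split=> //; exact: (ci_open_dom ci).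
suff : \forall y \near x, N (chart_extend phi y) by [].
near=> y; have dy : chart_dom c y by near: y.
rewrite chart_extend_in//.
suff : (@cube R n `&` O) (phi (c y)) by near: y.
by apply: phi_stable; exact: (ci_map ci).
Unshelve. all: by end_near. Qed.

End OneMap.

Lemma chart_extendK phi phi' : cancel phi phi' ->
  (forall z, ~ C z -> phi z = z) -> (forall z, ~ C z -> phi' z = z) ->
  cancel (chart_extend phi) (chart_extend phi').
Proof.
move=> phiK phiC phi'C x; have [dx|dx] := pselect (chart_dom c x); last first.
  by rewrite {2}/chart_extend asboolF// /chart_extend asboolF.
have dy := chart_extend_dom phiK phiC phi'C dx.
by rewrite chart_extend_in// (chart_extend_map phiK phiC phi'C dx) phiK (ci_mapK ci).
Qed.

Lemma chart_extend_PL phi phi' : cancel phi phi' -> cancel phi' phi ->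
  (forall z, ~ C z -> phi z = z) -> (forall z, ~ C z -> phi' z = z) ->
  continuous phi -> continuous phi' -> @PL_cube R n o phi ->
  PL_automorphism S (chart_extend phi).
Proof.
move=> phiK phi'K phiC phi'C cphi cphi' Pphi; split.
  exists (chart_extend phi'); split; [exact: chart_extendK|exact: chart_extendK| | ].
  - exact: (@chart_extend_continuous phi phi').
  - exact: (@chart_extend_continuous phi' phi).
move=> d e Sd Se x dx ex; have [cx|cx] := pselect (chart_dom c x); last first.
  have nx : ~ (gc @` C) x by move=> /support_dom.
  rewrite chart_extend_out// in ex.
  have [h Ph hE] := atlas_compat Sd Se dx ex; exists h => //.
  have nC := support_near nx.
  near=> y; rewrite chart_extend_out//; first by near: y.
  by near: y.
have cfx := chart_extend_dom phiK phiC phi'C cx.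
have [h Ph hE] := atlas_compat Sd Sc dx cx.
have [k Pk kE] := atlas_compat Sc Se cfx ex.
exists (k \o (phi \o h)); first by do 2 apply: PL_cube_comp => //.
have kE' : \forall y \near x, e (chart_extend phi y) = k (c (chart_extend phi y)).
  exact: (@chart_extend_continuous phi phi' phiK phiC phi'C cphi x _ kE).
have nd : \forall y \near x, chart_dom c y.
  by apply: open_nbhs_nbhs; split=> //; exact: (ci_open_dom ci).
near=> y; have dy : chart_dom c y by near: y.
have -> : e (chart_extend phi y) = k (c (chart_extend phi y)) by near: y.
rewrite (chart_extend_map phiK phiC phi'C dy) /=; congr (k (phi _)).
by near: y.
Unshelve. all: by end_near. Qed.

End Extension.

(** * PL homeomorphisms supported in an open set *)

Section PLGroupSupport.
Variables (R : realType) (o : bool) (n : nat) (M : topologicalType).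
Variable S : PL_structure R o n M.
Hypotheses (n0 : (0 < n)%N) (hM : hausdorff_space M).
Implicit Types (f g h : PL S) (U : set M).

Definition supported U f := forall x, ~ U x -> sval f x = x.

Lemma PL_continuous f : continuous (sval f).
Proof. by case: f => f [[g []]]. Qed.

Lemma PL_mulE f g x : sval (f * g)%g x = sval f (sval g x).
Proof. by []. Qed.

Lemma PL_oneE x : sval (1%g : PL S) x = x.
Proof. by []. Qed.

Lemma PL_invK f : cancel (sval f) (sval (f^-1)%g).
Proof. exact: PL_invfunK. Qed.

Lemma PL_invKV f : cancel (sval (f^-1)%g) (sval f).
Proof. exact: PL_invfunKV. Qed.

Lemma supported_inv U f : supported U f -> supported U (f^-1)%g.
Proof. by move=> Uf x Ux; rewrite -{1}(Uf x Ux) PL_invK. Qed.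

Lemma supported_mul U f g : supported U f -> supported U g -> supported U (f * g)%g.
Proof. by move=> Uf Ug x Ux; rewrite PL_mulE Ug// Uf. Qed.

Lemma supported_stable U f x : supported U f -> U x -> U (sval f x).
Proof.
move=> Uf Ux; apply: contrapT => nU; apply: (nU).
by have := Uf _ nU => /(can_inj (PL_invK f)) ->.
Qed.

Lemma PL_neq f g : f <> g -> exists x, sval f x <> sval g x.
Proof.
move=> fg; apply: contrapT => H; apply: fg; apply: PL_ext => x.
by apply: contrapT => fgx; apply: H; exists x.
Qed.

(** Read in a chart, g s moves the barycentre of a fixed small simplex towards one of its
    vertices by the fraction s of their distance. *)
Lemma bump_family U : open U -> U !=set0 -> exists g : R -> PL S,
  {in [set s : R | 0 <= s < 1] &, injective g} /\
  forall s, 0 <= s < 1 -> supported U (g s).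
Proof.
move=> oU [x Ux]; have [c Sc cx] := atlas_cover S x.
have [O [gc ci]] := chart_inverseP (atlas_chart Sc).
have Ocx := ci_map ci cx.
have nU : \forall z \near c x, (@cube R n `&` O) z -> U (gc z).
  by apply: (ci_inv_near ci) => //; rewrite (ci_mapK ci)//; exact: open_nbhs_nbhs.
pose O' := O `&` [set z | (@cube R n `&` O) z -> U (gc z)]°.
have oO' : open O' by apply: openI; [exact: (ci_open ci)|exact: open_interior].
have [K [v [tK vK vO']]] := small_simplex oO' (conj Ocx.2 nU) Ocx.1.
have vO : simplex v `<=` @cube R n `&` O.
  by move=> z vz; split; [exact: (tri_cube tK vK)|case: (vO' _ vz)].
have vU z : simplex v z -> U (gc z).
  by move=> vz; have [_ /nbhs_singleton/=] := vO' _ vz; apply; exact: vO.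
have av := tri_indep tK vK.
have kv : compact (simplex v).
  apply: subclosed_compact (@cube_compact R n) _; first exact: simplex_closed.
  by move=> z /vO[].
pose pi : 'rV[R]_n.+1 := uniform_weight R n.
have ipi : interior_weight pi := uniform_weight_interior R n.
pose pis (s : R) : 'rV[R]_n.+1 := (1 - s) *: pi + s *: delta_mx 0 ord0.
have ipis s : 0 <= s < 1 -> interior_weight (pis s).
  have pisE k : pis s 0 k = (1 - s) * pi 0 k + s * (delta_mx 0 ord0 : 'rV[R]_n.+1) 0 k.
    by rewrite /pis mxE [X in X + _]mxE [X in _ + X]mxE.
  move=> /andP[s0 s1]; split=> [k|].
    rewrite pisE ltr_pwDl ?mulr_gt0 ?subr_gt0 ?ipi.1//.
    by rewrite mulr_ge0// mxE ler0n.
  under eq_bigr do rewrite pisE.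
  by rewrite big_split/= -!mulr_sumr ipi.2 (delta_weight R ord0).2; ring.
have /choice[g gP] : forall s, exists f : PL S, 0 <= s < 1 ->
    sval f = chart_extend c gc (star_move v pi (pis s)).
  move=> s; have [s01|s01] := pselect (0 <= s < 1); last by exists 1%g => /s01.
  have H : PL_automorphism S (chart_extend c gc (star_move v pi (pis s))).
    apply: (chart_extend_PL hM Sc ci vO kv (phi' := star_move v (pis s) pi)).
    - by apply: star_moveK => //; exact: ipis.
    - by apply: star_moveK => //; exact: ipis.
    - by move=> z; exact: star_move_notin.
    - by move=> z; apply: star_move_notin => //; exact: ipis.
    - exact: star_move_continuous.
    - exact: star_move_continuous.
    - by apply: PL_cube_gen; apply: (star_move_pl av o tK vK ipi); exact: ipis.
  by exists (exist _ _ H).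
exists g; split.
  move=> s t; rewrite !inE => /= s01 t01 /(congr1 (fun f => c (sval f (gc (pi *m v))))).
  have vpi : simplex v (pi *m v) by apply/simplexP; exists pi => //; exact: interior_weightW.
  have dpi : chart_dom c (gc (pi *m v)) by apply: (ci_inv ci); exact: vO.
  have E u : 0 <= u < 1 -> c (sval (g u) (gc (pi *m v))) = pis u *m v.
    move=> u01; rewrite gP// (chart_extend_map ci vO (phi' := star_move v (pis u) pi))//.
    - by rewrite (ci_invK ci) ?star_move_apex//; exact: vO.
    - by apply: star_moveK => //; exact: ipis.
    - by move=> z; exact: star_move_notin.
    - by move=> z; apply: star_move_notin => //; exact: ipis.
  rewrite !E// => /(bary_inj av).
  rewrite (ipis s s01).2 (ipis t t01).2 => /(_ erefl)/rowP/(_ ord_max).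
  rewrite !mxE /= (_ : ord_max == ord0 = false); last first.
    by apply/negbTE; rewrite -(inj_eq val_inj)/= -lt0n.
  rewrite !mulr0 !addr0 => /mulIf st.
  have /st /eqP : (n.+1%:R^-1 : R) != 0 by rewrite invr_eq0 pnatr_eq0.
  by rewrite -subr_eq0 opprB addrCA [1 + _]addrC -addrA; move/eqP; lra.
move=> s s01 y Uy; rewrite gP//.
have nsup : ~ (gc @` simplex v) y by move=> [z vz zy]; apply: Uy; rewrite -zy; exact: vU.
have [dy|dy] := pselect (chart_dom c y); last by rewrite /chart_extend asboolF.
apply: (chart_extend_out ci) nsup => z; exact: star_move_notin.
Qed.

Lemma supported_commute U f g : supported U g -> (forall x, U x -> sval f x = x) ->
  (f * g = g * f)%g.
Proof.
move=> Ug fU; apply: PL_ext => x; rewrite !PL_mulE.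
have [Ux|nUx] := pselect (U x); first by rewrite fU ?fU//; exact: supported_stable.
rewrite Ug// Ug// => Ufx; apply: nUx.
by have /(can_inj (PL_invK f)) <- := fU _ Ufx.
Qed.

Lemma commute_fixes U f : open U ->
  (forall g, supported U g -> (f * g = g * f)%g) -> forall x, U x -> sval f x = x.
Proof.
move=> oU comm x Ux; apply: contrapT => fx.
have := hM; rewrite open_hausdorff => /(_ (sval f x) x).
case; first exact/eqP.
move=> [A B] /=; rewrite !inE => -[Afx Bx] [oA oB AB].
pose V := U `&` (B `&` sval f @^-1` A).
have oV : open V.
  by do 2 apply: openI => //; apply: open_comp => // y _; exact: PL_continuous.
have [g [ginj gV]] := @bump_family V oV (ex_intro _ x (conj Ux (conj Bx Afx))).
have h0 : 0 <= (0 : R) < 1 by rewrite lexx ltr01.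
have h2 : 0 <= (2^-1 : R) < 1 by apply/andP; split; lra.
have g02 : g 0 <> g 2^-1.
  by move=> /ginj; rewrite !inE => /(_ h0 h2)/eqP; rewrite eq_sym invr_eq0 pnatr_eq0.
(* V is disjoint from its image by f, so that g s is conjugated by f to a map that is
   the identity on V *)
suff H s : 0 <= s < 1 -> g s = 1%g by apply: g02; rewrite !H.
move=> s01; apply: PL_ext => z; rewrite PL_oneE.
have [Vz|nVz] := pselect (V z); last exact: gV.
have := comm (g s) (fun y nUy => gV s s01 y (fun Vy => nUy Vy.1)).
move=> /(congr1 (fun k => sval k z)); rewrite !PL_mulE.
rewrite [RHS](gV s s01) => [/(can_inj (PL_invK f))//|[_ [Bfz _]]].
have : (A `&` B) (sval f z) by split=> //; case: Vz => _ [].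
by rewrite AB.
Qed.

Section Polish.
Variable tau : Topological (PL S).
Hypothesis pol : polish_group_topology R tau.
Local Notation T := (Topological.Pack tau : topologicalType).

(** The topology induced on the elements supported in U is not discrete. *)
Lemma small_supported (W : set T) U : nbhs (1%g : T) W -> open U -> U !=set0 ->
  exists f : PL S, [/\ W f, supported U f & exists x, sval f x <> x].
Proof.
move=> W1 oU U0; have [g [ginj gU]] := bump_family oU U0.
have [s [t [s01 t01 st Wst]]] := polish_close pol ginj W1.
exists ((g s)^-1 * g t)%g; split=> //.
  by apply: supported_mul; [apply: supported_inv|]; exact: gU.
have [x xst] := PL_neq st; exists x; rewrite PL_mulE => e; apply: xst.
by rewrite -{1}e PL_invKV.
Qed.

(** Any nontrivial element supported in U shows that U has at least two points; remove one
    of them from U. *)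
Lemma small_supported_fixing (W : set T) U : nbhs (1%g : T) W -> open U -> U !=set0 ->
  exists f : PL S, [/\ W f, supported U f & exists x y,
    [/\ U x, U y, sval f x <> x & sval f y = y]].
Proof.
move=> W1 oU U0; have [h [_ hU [y hy]]] := small_supported (@filterT _ (nbhs (1%g : T)) _) oU U0.
have Uy : U y by apply: contrapT => /hU.
have oU' : open (U `&` ~` [set y]).
  apply: openI => //; rewrite openC; apply: accessible_closed_set1.
  exact: hausdorff_accessible.
have [|f [Wf fU [x fx]]] := small_supported W1 oU'.
  by exists (sval h y); split=> //; exact: supported_stable.
exists f; split=> //; first by move=> z nUz; apply: fU => -[].
exists x, y; split=> //; first by apply: contrapT => nUx; apply: fx; apply: fU => -[].
by apply: fU => -[_]; exact.
Qed.

(** The infinite product of small elements, one for each U i. *)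
Lemma disjoint_product (U : nat -> set M) :
  (forall i, open (U i)) -> (forall i, U i !=set0) ->
  (forall i j x, U i x -> U j x -> i = j) ->
  exists F : PL S, forall i, [/\ forall x, U i x -> U i (sval F x) &
    exists x y, [/\ U i x, U i y, sval F x <> x & sval F y = y]].
Proof.
move=> oU U0 Udisj.
have [|f [P [F [fS P0 PS PF]]]] := @polish_product R (PL S) tau pol (fun i => [set f : PL S |
    supported (U i) f /\ exists x y, [/\ U i x, U i y, sval f x <> x & sval f y = y]]).
  by move=> i W W1; have [f [Wf fU fxy]] := small_supported_fixing W1 (oU i) (U0 i); exists f.
have P_out j x : (forall i, (i < j)%N -> ~ U i x) -> sval (P j) x = x.
  elim: j => [|j IH] H; first by rewrite P0.
  rewrite PS PL_mulE (fS j).1 ?IH//; last exact: H.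
  by move=> i ij; apply: H; exact: ltnW.
have P_in j i x : (i < j)%N -> U i x -> sval (P j) x = sval (f i) x.
  elim: j => [//|j IH]; rewrite ltnS leq_eqVlt PS PL_mulE => /orP[/eqP ->|ij] Ux.
    apply: P_out => k kj Uk; have := Udisj k j _ Uk (supported_stable (fS j).1 Ux).
    by move=> e; rewrite e ltnn in kj.
  rewrite (fS j).1 ?IH// => Ujx; have e := Udisj _ _ _ Ux Ujx.
  by rewrite e ltnn in ij.
have F_in i x : U i x -> sval F x = sval (f i) x.
  move=> Ux; have Ufx := supported_stable (fS i).1 Ux.
  have : sval (F * (f i)^-1)%g (sval (f i) x) = sval (f i) x.
    apply: (@commute_fixes (U i) (F * (f i)^-1)%g (oU i) _ _ Ufx) => g Ug.
    (* from the i-th factor on, the partial products agree with f i on U i *)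
    apply: (polish_lim_commute pol (P := P) (N := i.+1)) => // j ij.
    apply: (supported_commute Ug) => y Uy; rewrite PL_mulE.
    rewrite (P_in _ _ _ ij) ?PL_invKV//.
    exact: (supported_stable (supported_inv (fS i).1)).
  by rewrite PL_mulE PL_invK.
exists F => i; split.
  by move=> x Ux; rewrite (F_in i)//; exact: (supported_stable (fS i).1).
have [x [y [Ux Uy fx fy]]] := (fS i).2; exists x, y; by split=> //; rewrite (F_in i).
Qed.

End Polish.

(** F fixes the limit p0 of the scattered balls, since it fixes a point of each, and near
    p0 it is made of finitely many affine maps; one of the balls then contradicts
    [finite_affine_rigid]. *)
Lemma not_all_moved (F : PL S) (c : chart R n M) O gc (p0 : 'rV[R]_n) (r : R) :
  atlas S c -> chart_inverse c O gc -> 0 < r -> ball p0 r `<=` @cube R n `&` O ->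
  ~ forall i, let U := chart_dom c `&` c @^-1` (scattered p0 r i) in
    (forall x, U x -> U (sval F x)) /\
    exists x y, [/\ U x, U y, sval F x <> x & sval F y = y].
Proof.
move=> Sc ci r0 pO H; pose U i := chart_dom c `&` c @^-1` (scattered p0 r i).
have {}H i : (forall x, U i x -> U i (sval F x)) /\
  exists x y, [/\ U i x, U i y, sval F x <> x & sval F y = y] := H i.
have int_O z : ball p0 r z -> nbhs z (@cube R n `&` O).
  move=> pz; apply: (@filterS _ _ _ _ _ pO); apply: open_nbhs_nbhs; split=> //.
  exact: ball_open.
have p0p : ball p0 r p0 by exact: ballxx.
have scat_ball := scattered_sub r0 (p0 := p0).
pose x1 := gc p0.
have Op := pO _ p0p.
have U_near (N : set M) : nbhs x1 N -> exists i0, forall i, (i0 <= i)%N -> U i `<=` N.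
  move=> nN; have /nbhs_ballP[e /= e0 eN] := ci_inv_at ci (int_O _ p0p) nN.
  have [i0 He] := scattered_small r0 e0; exists i0 => i i0i y [dy sy].
  rewrite -(ci_mapK ci dy); apply: eN; apply: le_ball (He _ i0i) _ _.
  exact: scattered_ball sy.
have Fx1 : sval F x1 = x1.
  apply: contrapT => nF.
  have nn := near_neq hM (@PL_continuous F x1) (@cvg_id _ (nbhs x1)) nF.
  have [i0 Hi0] := U_near _ nn.
  have [_ [_ [y [_ Uy _ Fy]]]] := H i0.
  exact: (Hi0 i0 (leqnn _) y Uy).
have d1 : chart_dom c x1 := ci_inv ci Op.
have [g Pg gE] := (svalP F).2 c c Sc Sc x1 d1 (eq_ind_r _ d1 Fx1).
have [L _ gL] := PL_cube_pieces Pg.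
have [i0 Hi0] := U_near _ gE.
have [|i i0i avoid] := @scattered_avoid R n p0 r r0 [seq p <- L | p != (1%:M, 0)] i0.
  by move=> p; rewrite mem_filter => /andP[].
have [FU [x [y [Ux Uy Fx Fy]]]] := H i.
pose phi z := c (sval F (gc z)).
have D_dom z : scattered p0 r i z -> U i (gc z).
  move=> sz; have Oz := pO _ (scat_ball _ _ sz); split; first exact: (ci_inv ci).
  by rewrite /preimage/= (ci_invK ci).
have rigid : forall z, scattered p0 r i z -> phi z = z.
  apply: (@finite_affine_rigid R n L _ phi (c y)).
  - exact: scattered_open.
  - exact: scattered_connected.
  - move=> z sz; have nz := int_O _ (scat_ball _ _ sz).
    apply: (@continuous_comp _ _ _ (sval F \o gc) c).
      apply: (@continuous_comp _ _ _ gc (sval F)); first exact: (ci_inv_at ci).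
      exact: PL_continuous.
    by apply: (ci_map_cont ci); case: (FU _ (D_dom _ sz)).
  - move=> z sz; have Oz := pO _ (scat_ball _ _ sz).
    have [p pL gz] := gL z Oz.1; exists p => //; rewrite -gz /phi.
    by rewrite (Hi0 _ i0i _ (D_dom _ sz)) (ci_invK ci).
  - by move=> p z pL p1; apply: avoid; rewrite mem_filter p1.
  - by case: Uy.
  - by rewrite /phi (ci_mapK ci) ?Fy//; case: Uy.
apply: Fx; have [dx sx] := Ux; have [dFx _] := FU _ Ux.
have := rigid _ sx; rewrite /phi (ci_mapK ci)// => e.
by rewrite -(ci_mapK ci dFx) e (ci_mapK ci).
Qed.

End PLGroupSupport.

Theorem theorem1p1 (R : realType) (oriented : bool) (n : nat)
    (M : topologicalType) (S : PL_structure R oriented n M) :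
  (0 < n)%N -> [set: M] !=set0 -> hausdorff_space M -> @second_countable M ->
  ~ admits_polish_group_topology R (PL S).
Proof.
move=> n0 [x _] hM _ [tau pol].
have [c Sc cx] := atlas_cover S x.
have [O [gc ci]] := chart_inverseP (atlas_chart Sc).
have [Icx Ocx] := ci_map ci cx.
have [p0 [r [r0 pO]]] : exists p (r : R), 0 < r /\ ball p r `<=` @cube R n `&` O.
  have [K [v [tK vK vO]]] := small_simplex (ci_open ci) Ocx Icx.
  have ipi := uniform_weight_interior R n.
  have /nbhs_ballP[r /= r0 rv] := simplex_nbhs (tri_indep tK vK) ipi.
  exists (uniform_weight R n *m v), r; split=> // z /rv vz.
  by split; [exact: (tri_cube tK vK) vz|exact: vO].
pose U i := chart_dom c `&` c @^-1` (scattered p0 r i).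
have [|||F HF] := @disjoint_product R oriented n M S n0 hM tau pol U.
- move=> i; rewrite openE => y [dy sy]; apply: filterI.
    by apply: open_nbhs_nbhs; split=> //; exact: (ci_open_dom ci).
  apply: (ci_map_cont ci dy); apply: open_nbhs_nbhs; split=> //; exact: scattered_open.
- move=> i; have [z sz] := scattered_nonempty p0 r0 i.
  have Oz : (@cube R n `&` O) z.
    by apply: pO; exact: scattered_sub sz.
  by exists (gc z); split; [exact: (ci_inv ci)|rewrite /preimage/= (ci_invK ci)].
- by move=> i j y [_ yi] [_ yj]; exact: (scattered_disjoint n0 r0 yi yj).
exact: (@not_all_moved R oriented n M S hM F c O gc p0 r Sc ci r0 pO).
Qed.
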